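(* For $i=1,\dots,n$ let $(Y_i,y_i)\to(X,x)$ be based local isometries of finite virtually special cube complexes. Then there is a finite cover $(\dot X,\dot x)\to(X,x)$ such that the based elevations $\dot Y_i$ of $Y_i$ to $(\dot X,\dot x)$ are embedded in $\dot X$ and have connected intersections $\bigcap_{i\in E}\dot Y_i$ for every $\emptyset\neq E\subset\{1,\dots,n\}$. Moreover, if the $Y_i$ are embedded in $X$ and do not inter-osculate with hyperplanes of $X$, then the cover may be chosen so that in addition the covering map $\dot X\to X$ is injective on $\bigcap_{i=1}^n\dot Y_i$.
   Context: Cube complexes and their covers are connected. In a cube complex $X$, vertices, edges and squares are the 0-, 1- and 2-cubes, and $X^n$ is the $n$-skeleton. $X$ is non-positively curved if all vertex links are flag simplicial complexes. Basepoints are vertices. Two edges are elementary parallel if they are opposite edges of a square; parallelism is the equivalence relation this generates. Each edge $e$ has a dual hyperplane $H(e)$, and $H(e_1)=H(e_2)$ if and only if $e_1,e_2$ are parallel. Suppose distinct edges $e_1,e_2$ are incident at a vertex $x$. If they form the corner of a square at $x$, then $H(e_1),H(e_2)$ intersect (and $H(e_1)$ self-intersects if $H(e_1)=H(e_2)$); if they do not form the corner of a square at $x$, then $H(e_1),H(e_2)$ osculate (and $H(e_1)$ self-osculates if $H(e_1)=H(e_2)$). If an edge $e$ has both ends at the same vertex then $H(e)$ also self-osculates. Distinct hyperplanes inter-osculate if they both intersect and osculate. A hyperplane $H$ is two-sided if the map $H\to X$ extends to a combinatorial map $H\times[-1,1]\to X$. A non-positively curved cube complex is directly special if every hyperplane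 is two-sided, no hyperplane self-intersects or self-osculates, and no two hyperplanes inter-osculate. It is virtually special if it has a finite-sheeted directly special cover. A local isometry $\phi:Y\to X$ of non-positively curved cube complexes is a combinatorial map such that each induced map $\operatorname{link}(y)\to\operatorname{link}(\phi(y))$ is an embedding with image a full subcomplex. Let $\phi:Y\to X$ be a local isometry and $H$ a hyperplane of $X$. $H$ and $Y$ intersect if $H$ intersects $\phi(Y)$ (equivalently $H=H(\phi(f))$ for some edge $f$ of $Y$). $H$ and $Y$ osculate if there are a vertex $y\in Y^0$ and an edge $e$ of $X$ incident to $\phi(y)$ with $H=H(e)$ such that no edge $f$ of $Y$ incident to $y$ has $\phi(f)=e$. $H$ and $Y$ inter-osculate if they both intersect and osculate. Given a local isometry $\phi:Y\to X$ and a finite cover $\mu:\hat X\to X$, an elevation of $\phi$ (or of $Y$) to $\hat X$ is a map $\hat\phi:\hat Y\to\hat X$ together with a covering $\nu:\hat Y\to Y$ such that $\mu\hat\phi=\phi\nu$ and a path in $\hat Y$ closes up as a loop if and only if its projections to $Y$ and $\hat X$ both close up as loops; equivalently, $\hat Y$ is a component of the pullback of $\phi$ and $\mu$. If all these maps are maps of based spaces, it is the based elevation. An embedded elevation is identified with its image subcomplex. *)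

(* Defs.v *)
From mathcomp Require Import all_boot.
From mathcomp Require Import boolp classical_sets cardinality.
From Stdlib Require Import Relations.
From Stdlib Require List.

Set Implicit Arguments.
Unset Strict Implicit.
Unset Printing Implicit Defensive.

Local Open Scope classical_set_scope.

(** * Standard cubes and their faces

    [corner n] is the vertex set of the standard cube [0,1]^n.  A Hamming
    isometry {0,1}^m -> {0,1}^n is the same thing as the restriction to
    vertices of an isometry from [0,1]^m onto an m-dimensional face of [0,1]^n:
    up to reflections it permutes the m coordinates and inserts n - m constant
    ones.  In particular [faceMap n n] is the symmetry group of [0,1]^n. *)
Definition corner (n : nat) := {ffun 'I_n -> bool}.

Definition hamming n (u v : corner n) : nat := \sum_(i < n) (u i != v i).

Definition isometric m n (f : {ffun corner m -> corner n}) : bool :=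
  [forall u, forall v, hamming (f u) (f v) == hamming u v].

Definition faceMap m n := {f : {ffun corner m -> corner n} | isometric f}.

Lemma isometricP m n (f : {ffun corner m -> corner n}) :
  reflect (forall u v, hamming (f u) (f v) = hamming u v) (isometric f).
Proof.
apply: (iffP idP) => [H u v|H].
  by move/forallP/(_ u)/forallP/(_ v)/eqP: H.
by apply/forallP => u; apply/forallP => v; apply/eqP.
Qed.

Lemma faceMapE m n (f g : faceMap m n) : val f =1 val g -> f = g.
Proof. by move=> fg; apply: val_inj; apply/ffunP. Qed.

Lemma fm_id_subproof n : isometric [ffun u : corner n => u].
Proof. by apply/isometricP => u v; rewrite !ffunE. Qed.
Definition fm_id n : faceMap n n := Sub _ (fm_id_subproof n).

Lemma fm_comp_subproof l m n (g : faceMap m n) (f : faceMap l m) :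
  isometric [ffun u => val g (val f u)].
Proof.
apply/isometricP => u v; rewrite !ffunE.
by rewrite (isometricP _ (valP g)) (isometricP _ (valP f)).
Qed.
Definition fm_comp l m n (g : faceMap m n) (f : faceMap l m) : faceMap l n :=
  Sub _ (fm_comp_subproof g f).

Lemma fm_vertex_subproof n (w : corner n) : isometric [ffun _ : corner 0 => w].
Proof.
apply/isometricP => u v; rewrite !ffunE /hamming big_ord0.
by apply: big1 => i _; rewrite eqxx.
Qed.
Definition fm_vertex n (w : corner n) : faceMap 0 n :=
  Sub _ (fm_vertex_subproof w).

(* The edge of [0,1]^n in direction i whose other coordinates agree with w,
   oriented from coordinate 0 to coordinate 1. *)
Lemma fm_edge_subproof n (w : corner n) (i : 'I_n) :
  isometric [ffun u : corner 1 =>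
    [ffun j : 'I_n => if j == i then u ord0 else w j]].
Proof.
apply/isometricP => u v; rewrite !ffunE /hamming big_ord1 (bigD1 i) //=.
rewrite !ffunE eqxx big1 ?addn0 // => j /negPf ji.
by rewrite !ffunE ji eqxx.
Qed.
Definition fm_edge n (w : corner n) (i : 'I_n) : faceMap 1 n :=
  Sub _ (fm_edge_subproof w i).

(* [fm_prod b g] is the product [0,1] x [0,1]^m -> [0,1] x [0,1]^n of g with the
   identity (b = false) or with the reflection (b = true) of coordinate 0. *)
Lemma fm_prod_subproof (b : bool) m n (g : faceMap m n) :
  isometric [ffun u : corner m.+1 => [ffun j : 'I_n.+1 =>
    if unlift ord0 j is Some k
    then val g [ffun i : 'I_m => u (lift ord0 i)] k else b (+) u ord0]].
Proof.
apply/isometricP => u v; rewrite !ffunE /hamming !big_ord_recl.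
rewrite !ffunE unlift_none (inj_eq (can_inj (addKb b))); congr (_ + _).
transitivity (hamming (val g [ffun i : 'I_m => u (lift ord0 i)])
                      (val g [ffun i : 'I_m => v (lift ord0 i)])).
  by apply: eq_bigr => i _; rewrite !ffunE liftK.
rewrite (isometricP _ (valP g)) /hamming.
by apply: eq_bigr => i _; rewrite !ffunE.
Qed.
Definition fm_prod (b : bool) m n (g : faceMap m n) : faceMap m.+1 n.+1 :=
  Sub _ (fm_prod_subproof b g).

Definition corner0 n : corner n := [ffun=> false].
Definition corner1 n : corner n := [ffun=> true].

(** * Cube complexes

    [cube X n] is the set of characteristic maps [0,1]^n -> X of the n-cubes of
    X, and [face f s] is the composite of s with f.  An n-cube of X is thus an
    orbit of the action of the symmetries of [0,1]^n on [cube X n].  This action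
    is free because a characteristic map is injective on the open cube.  So
    [X 0] is the set of vertices of X and [X 1] the set of oriented edges. *)
Record cubeCells := CubeCells {
  cube :> nat -> Type;
  face : forall m n, faceMap m n -> cube n -> cube m;
  face_id : forall n (s : cube n), face (fm_id n) s = s;
  face_comp : forall l m n (g : faceMap m n) (f : faceMap l m) (s : cube n),
    face (fm_comp g f) s = face f (face g s);
  face_free : forall n (f : faceMap n n) (s : cube n), face f s = s -> f = fm_id n
}.
Arguments face {c m n}.

Section Cells.
Variable X : cubeCells.

(* The image of the vertex 0 of [0,1]^n. *)
Definition base n (s : X n) : X 0 := face (fm_vertex (corner0 n)) s.

(* The edge of s in direction i which starts at [base s]. *)
Definition axis n (i : 'I_n) (s : X n) : X 1 := face (fm_edge (corner0 n) i) s.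

Definition src (e : X 1) : X 0 := face (fm_vertex (corner0 1)) e.
Definition tgt (e : X 1) : X 0 := face (fm_vertex (corner1 1)) e.
Definition reverse (e : X 1) : X 1 := face (fm_prod true (fm_id 0)) e.

(* Equality of the underlying unoriented edges. *)
Definition same_edge (e e' : X 1) : Prop := e' = e \/ e' = reverse e.

Definition incident (e : X 1) (v : X 0) : Prop := src e = v \/ tgt e = v.

(* p is an edge path from u to v. *)
Fixpoint walk (u : X 0) (p : seq (X 1)) (v : X 0) : Prop :=
  if p is e :: p' then src e = u /\ walk (tgt e) p' v else u = v.

(* A subcomplex is given by its characteristic maps. *)
Definition subcomplex_connected (A : forall n, set (X n)) : Prop :=
  (exists v, A 0 v) /\
  forall u v, A 0 u -> A 0 v ->
    exists p, walk u p v /\ forall e, List.In e p -> A 1 e.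

End Cells.

Record cubeComplex := CubeComplex {
  cells :> cubeCells;
  cells_connected : subcomplex_connected (fun n => [set: cells n])
}.

Definition finite_complex (X : cubeComplex) : Prop :=
  finite_set [set: {n : nat & X n}].

Record cubeMap (X Y : cubeCells) := CubeMap {
  cmap :> forall n, X n -> Y n;
  cmap_face : forall m n (f : faceMap m n) (s : X n),
    cmap (face f s) = face f (cmap s)
}.

Definition embedded (X Y : cubeCells) (f : cubeMap X Y) : Prop :=
  forall n, injective (f n).

(** * Links

    A pair of an n-cube and one of its vertices mapped to v is an
    (n-1)-simplex of link(v); the orderings of the vertices of this simplex
    correspond to the s : X n with [base s = v], and the vertices of the simplex
    are then the [axis i s].  So the vertices of link(v) are the oriented edges
    starting at v. *)
Section Links.
Variable X : cubeCells.

Definition link_simplicial (v : X 0) : Prop :=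
  (forall n (s : X n), base s = v -> injective (fun i => axis i s)) /\
  (forall n (s t : X n), base s = v -> base t = v ->
     (forall i, axis i s = axis i t) -> s = t).

Definition link_adjacent (v : X 0) (a b : X 1) : Prop :=
  exists q : X 2, [/\ base q = v, axis ord0 q = a & axis ord_max q = b].

Definition link_flag (v : X 0) : Prop :=
  forall n (a : 'I_n -> X 1), injective a -> (forall i, src (a i) = v) ->
    (forall i j, i != j -> link_adjacent v (a i) (a j)) ->
    exists s : X n, base s = v /\ forall i, axis i s = a i.

Definition nonpositively_curved : Prop :=
  forall v, link_simplicial v /\ link_flag v.

End Links.

Section Maps.
Variables (X Y : cubeCells) (f : cubeMap Y X).

Definition link_embedding (y : Y 0) : Prop :=
  forall n (s t : Y n), base s = y -> base t = y -> f n s = f n t -> s = t.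

(* The image of link(y) is a full subcomplex of link(f(y)). *)
Definition link_full (y : Y 0) : Prop :=
  forall n (s : X n), base s = f 0 y ->
    (forall i, exists e : Y 1, src e = y /\ f 1 e = axis i s) ->
    exists t : Y n, base t = y /\ f n t = s.

Definition local_isometry : Prop :=
  forall y, link_embedding y /\ link_full y.

(* f restricts to an isomorphism between the links of y and f(y), for all y. *)
Definition covering : Prop :=
  forall (y : Y 0) n (s : X n), base s = f 0 y ->
    exists! t : Y n, base t = y /\ f n t = s.

Definition finite_sheeted : Prop :=
  forall x : X 0, finite_set [set y | f 0 y = x].

End Maps.

(** * Hyperplanes *)
Section Hyperplanes.
Variable X : cubeCells.

Definition elementary_parallel (e1 e2 : X 1) : Prop :=
  exists q : X 2,
    same_edge (face (fm_edge (corner0 2) ord0) q) e1 /\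
    same_edge (face (fm_edge (corner1 2) ord0) q) e2.

Definition parallel : relation (X 1) :=
  clos_refl_sym_trans (X 1)
    (fun e1 e2 => same_edge e1 e2 \/ elementary_parallel e1 e2).

(* A hyperplane is represented by the set of its dual edges, with both
   orientations. *)
Definition hyp (e : X 1) : set (X 1) := [set e' | parallel e e'].

Definition hyperplane (H : set (X 1)) : Prop := exists e, H = hyp e.

Definition square_corner (e1 e2 : X 1) (x : X 0) : Prop :=
  exists q : X 2, [/\ base q = x,
    same_edge (axis ord0 q) e1 & same_edge (axis ord_max q) e2].

Definition hyp_intersect (H1 H2 : set (X 1)) : Prop :=
  exists (e1 e2 : X 1) (x : X 0),
    [/\ H1 = hyp e1, H2 = hyp e2, ~ same_edge e1 e2,
        incident e1 x /\ incident e2 x & square_corner e1 e2 x].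

Definition hyp_osculate (H1 H2 : set (X 1)) : Prop :=
  exists (e1 e2 : X 1) (x : X 0),
    [/\ H1 = hyp e1, H2 = hyp e2, ~ same_edge e1 e2,
        incident e1 x /\ incident e2 x & ~ square_corner e1 e2 x].

Definition self_intersect (H : set (X 1)) : Prop := hyp_intersect H H.

Definition self_osculate (H : set (X 1)) : Prop :=
  hyp_osculate H H \/ exists e : X 1, H = hyp e /\ src e = tgt e.

Definition hyp_inter_osculate (H1 H2 : set (X 1)) : Prop :=
  [/\ H1 <> H2, hyp_intersect H1 H2 & hyp_osculate H1 H2].

(* The n-cubes of H are the midcubes transverse to an edge dual to H.  A
   characteristic map of such a midcube is some s : X n.+1 with
   [H (axis ord0 s)], considered up to reflection of coordinate 0.  A
   combinatorial map H x [-1,1] -> X extending H -> X sends the product of this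
   midcube with [-1,1] to a cube [ext s] which has that same midcube, hence is
   s or its reflection. *)
Definition two_sided (H : set (X 1)) : Prop :=
  exists ext : forall n, X n.+1 -> X n.+1,
    forall n (s : X n.+1), H (axis ord0 s) ->
      [/\ ext n s = s \/ ext n s = face (fm_prod true (fm_id n)) s,
          ext n (face (fm_prod true (fm_id n)) s) = ext n s
        & forall m (g : faceMap m n),
            ext m (face (fm_prod false g) s) = face (fm_prod false g) (ext n s)].

Definition directly_special : Prop :=
  nonpositively_curved X /\
  forall H, hyperplane H ->
    [/\ two_sided H, ~ self_intersect H, ~ self_osculate H
      & forall H', hyperplane H' -> ~ hyp_inter_osculate H H'].

End Hyperplanes.

Definition virtually_special (X : cubeComplex) : Prop :=
  nonpositively_curved X /\
  exists (X' : cubeComplex) (mu : cubeMap X' X),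
    [/\ covering mu, finite_sheeted mu & directly_special X'].

Section HyperplaneMap.
Variables (X Y : cubeCells) (f : cubeMap Y X).

Definition hyp_map_intersect (H : set (X 1)) : Prop :=
  exists e : Y 1, H = hyp (f 1 e).

Definition hyp_map_osculate (H : set (X 1)) : Prop :=
  exists (y : Y 0) (e : X 1),
    [/\ incident e (f 0 y), H = hyp e
      & ~ exists e' : Y 1, incident e' y /\ same_edge (f 1 e') e].

Definition hyp_map_inter_osculate (H : set (X 1)) : Prop :=
  hyp_map_intersect H /\ hyp_map_osculate H.

End HyperplaneMap.

(** * Elevations *)
Record basedElevation (X Y Xh : cubeComplex) (phi : cubeMap Y X)
    (mu : cubeMap Xh X) (y : Y 0) (xh : Xh 0) := BasedElevation {
  elev_dom : cubeComplex;
  elev_base : elev_dom 0;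
  elev_map : cubeMap elev_dom Xh;
  elev_cov : cubeMap elev_dom Y;
  elev_map_base : elev_map 0 elev_base = xh;
  elev_cov_base : elev_cov 0 elev_base = y;
  elev_covering : covering elev_cov;
  elev_comm : forall n (s : elev_dom n),
    mu n (elev_map n s) = phi n (elev_cov n s);
  elev_loops : forall (u v : elev_dom 0) (p : seq (elev_dom 1)), walk u p v ->
    (u = v <-> elev_cov 0 u = elev_cov 0 v /\ elev_map 0 u = elev_map 0 v)
}.

(* The common part, in Xh, of the images of the elevations indexed by E. *)
Definition elev_inter (n : nat) (X Xh : cubeComplex) (Y : 'I_n -> cubeComplex)
    (phi : forall i, cubeMap (Y i) X) (mu : cubeMap Xh X)
    (y : forall i, Y i 0) (xh : Xh 0)
    (D : forall i, basedElevation (phi i) mu (y i) xh) (E : set 'I_n) :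
    forall m, set (Xh m) :=
  fun m => \bigcap_(i in E) range (elev_map (D i) m).
Arguments elev_inter {n X Xh Y phi mu y xh} D E m.

(** * Existence of based elevations

    The component of the pullback which contains the base point is a based
    elevation, so that quantifying over [basedElevation] is not vacuous. *)
Section Walks.
Variable X : cubeCells.

Lemma walk_cat (u v w : X 0) p q : walk u p v -> walk v q w -> walk u (p ++ q) w.
Proof. by elim: p u => [u -> //|e p IH u /= [-> /IH{}IH] /IH]. Qed.

Lemma src_reverse (e : X 1) : src (reverse e) = tgt e.
Proof.
rewrite /src /tgt /reverse -face_comp; congr (face _ e).
apply: faceMapE => u; rewrite !ffunE /=; apply/ffunP => j.
by rewrite !ffunE ord1 unlift_none.
Qed.

Lemma tgt_reverse (e : X 1) : tgt (reverse e) = src e.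
Proof.
rewrite /src /tgt /reverse -face_comp; congr (face _ e).
apply: faceMapE => u; rewrite !ffunE /=; apply/ffunP => j.
by rewrite !ffunE ord1 unlift_none.
Qed.

Definition reach (u v : X 0) := exists p, walk u p v.

Lemma reach_refl u : reach u u. Proof. by exists [::]. Qed.

Lemma reach_trans u v w : reach u v -> reach v w -> reach u w.
Proof. by move=> [p hp] [q hq]; exists (p ++ q); apply: walk_cat hq. Qed.

Lemma reach_sym u v : reach u v -> reach v u.
Proof.
case=> p; elim: p u => [u ->|e p IH u /= [<- /IH h]]; first exact: reach_refl.
apply: reach_trans h _; exists [:: reverse e] => /=.
by rewrite src_reverse tgt_reverse.
Qed.

Lemma reach_corner n (s : X n) (w : corner n) :
  reach (base s) (face (fm_vertex w) s).
Proof.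
have [k] := ubnP #|[pred i | w i]|; elim: k w => // k IH w.
case: (pickP [pred i | w i]) => [i /= wi|w0] hk; last first.
  have -> : w = corner0 n by apply/ffunP => i; rewrite ffunE; apply: w0.
  exact: reach_refl.
pose w' : corner n := [ffun j => (j != i) && w j].
have w'w : (#|[pred j | w' j]| < k)%N.
  move: hk; rewrite (cardD1 i) inE wi add1n ltnS; apply: leq_trans.
  rewrite ltnS; apply: subset_leq_card; apply/fintype.subsetP => j.
  by rewrite !inE ffunE.
apply: reach_trans (IH _ w'w) _; exists [:: face (fm_edge w' i) s] => /=.
split; rewrite /src /tgt -face_comp; congr (face _ s).
  apply: faceMapE => u; rewrite !ffunE /=; apply/ffunP => j; rewrite !ffunE.
  by case: eqP.
apply: faceMapE => u; rewrite !ffunE /=; apply/ffunP => j; rewrite !ffunE.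
by case: eqP => [->|//]; rewrite wi.
Qed.

Lemma base_vertex (v : X 0) : base v = v.
Proof.
rewrite -[RHS]face_id; congr (face _ v); apply: faceMapE => u.
by rewrite !ffunE; apply/ffunP => -[].
Qed.

Lemma base_face m n (f : faceMap m n) (s : X n) :
  base (face f s) = face (fm_vertex (val f (corner0 m))) s.
Proof.
by rewrite /base -face_comp; congr (face _ s); apply: faceMapE => u; rewrite !ffunE.
Qed.

End Walks.

Lemma sig_inj (T : Type) (P : T -> Prop) (u v : {x | P x}) :
  proj1_sig u = proj1_sig v -> u = v.
Proof.
case: u v => [u pu] [v pv] /= uv; subst v; congr exist; exact: Prop_irrelevance.
Qed.

Section Component.
Variables (X : cubeCells) (v0 : X 0).

Definition comp_cube n := {s : X n | reach v0 (base s)}.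

Lemma comp_face_subproof m n (f : faceMap m n) (s : comp_cube n) :
  reach v0 (base (face f (proj1_sig s))).
Proof.
case: s => s h /=; apply: reach_trans h _.
by rewrite base_face; apply: reach_corner.
Qed.

Definition comp_face m n (f : faceMap m n) (s : comp_cube n) : comp_cube m :=
  exist (fun t : X m => reach v0 (base t)) (face f (proj1_sig s)) (comp_face_subproof f s).

Lemma comp_face_id n (s : comp_cube n) : comp_face (fm_id n) s = s.
Proof. by apply: sig_inj; apply: face_id. Qed.

Lemma comp_face_comp l m n (g : faceMap m n) (f : faceMap l m) (s : comp_cube n) :
  comp_face (fm_comp g f) s = comp_face f (comp_face g s).
Proof. by apply: sig_inj; apply: face_comp. Qed.

Lemma comp_face_free n (f : faceMap n n) (s : comp_cube n) :
  comp_face f s = s -> f = fm_id n.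
Proof. by move/(congr1 (@proj1_sig _ _)); apply: face_free. Qed.

Definition comp_cells := CubeCells comp_face_id comp_face_comp comp_face_free.

Lemma comp_v0_subproof : reach v0 (base v0).
Proof. by rewrite base_vertex; apply: reach_refl. Qed.

Definition comp_v0 : comp_cells 0 :=
  exist (fun t : X 0 => reach v0 (base t)) v0 comp_v0_subproof.

Lemma comp_reach (u v : comp_cells 0) :
  reach (proj1_sig u) (proj1_sig v) -> reach u v.
Proof.
case=> p; elim: p u => [u /= uv|e p IH u /= [eu ev]].
  by rewrite (sig_inj uv); apply: reach_refl.
have he : reach v0 (base e).
  by have := proj2_sig u; rewrite base_vertex -eu.
pose e' : comp_cells 1 := exist (fun t : X 1 => reach v0 (base t)) e he.
have /IH h : walk (proj1_sig (tgt e')) p (proj1_sig v) by [].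
apply: reach_trans h; exists [:: e'] => /=; split=> //.
exact: sig_inj.
Qed.

Lemma comp_connected : subcomplex_connected (fun n => [set: comp_cells n]).
Proof.
split=> [|u v _ _]; first by exists comp_v0.
have [] : reach u v; last by move=> p hp; exists p.
apply: comp_reach; have := proj2_sig u; have := proj2_sig v.
by rewrite !base_vertex => hv /reach_sym hu; apply: reach_trans hv.
Qed.

Definition component := CubeComplex comp_connected.

End Component.

Section Pullback.
Variables (X Y Xh : cubeComplex) (phi : cubeMap Y X) (mu : cubeMap Xh X).

Definition pb_cube n := {p : Y n * Xh n | phi n p.1 = mu n p.2}.

Lemma pb_face_subproof m n (f : faceMap m n) (s : pb_cube n) :
  phi m (face f (proj1_sig s).1) = mu m (face f (proj1_sig s).2).
Proof. by rewrite !cmap_face (proj2_sig s). Qed.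

Definition pb_face m n (f : faceMap m n) (s : pb_cube n) : pb_cube m :=
  exist (fun p : Y m * Xh m => phi m p.1 = mu m p.2)
    (face f (proj1_sig s).1, face f (proj1_sig s).2) (pb_face_subproof f s).

Lemma pb_face_id n (s : pb_cube n) : pb_face (fm_id n) s = s.
Proof. by apply: sig_inj; case: s => -[a b] h /=; rewrite !face_id. Qed.

Lemma pb_face_comp l m n (g : faceMap m n) (f : faceMap l m) (s : pb_cube n) :
  pb_face (fm_comp g f) s = pb_face f (pb_face g s).
Proof. by apply: sig_inj; case: s => -[a b] h /=; rewrite !face_comp. Qed.

Lemma pb_face_free n (f : faceMap n n) (s : pb_cube n) :
  pb_face f s = s -> f = fm_id n.
Proof. by move/(congr1 (fun p => (proj1_sig p).1)); apply: face_free. Qed.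

Definition pullback := CubeCells pb_face_id pb_face_comp pb_face_free.

Lemma basedElevation_exists (y : Y 0) (xh : Xh 0) :
  covering mu -> phi 0 y = mu 0 xh -> inhabited (basedElevation phi mu y xh).
Proof.
move=> mu_cov yxh.
pose v0 : pullback 0 := exist _ (y, xh) yxh.
pose Z := component v0.
pose pY : cubeMap Z Y := @CubeMap Z Y
  (fun n s => (proj1_sig (proj1_sig s)).1) (fun m n f s => erefl).
pose pX : cubeMap Z Xh := @CubeMap Z Xh
  (fun n s => (proj1_sig (proj1_sig s)).2) (fun m n f s => erefl).
constructor; apply: (@BasedElevation _ _ _ _ _ _ _ Z (comp_v0 v0) pX pY) => //.
- move=> z n s sz.
  have bs : base (phi n s) = mu 0 (pX 0 z).
    by rewrite /base -cmap_face -/(base s) sz; exact: (proj2_sig (proj1_sig z)).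
  have [t [[tz mut] t_uniq]] := mu_cov _ _ _ bs.
  pose st : pullback n :=
    exist (fun p : Y n * Xh n => phi n p.1 = mu n p.2) (s, t) (esym mut).
  have bst : base st = proj1_sig z.
    by apply: sig_inj; rewrite [RHS]surjective_pairing; congr pair.
  have hst : reach v0 (base st).
    by rewrite bst; have := proj2_sig z; rewrite base_vertex.
  exists (exist _ st hst); split; first by split=> //; apply: sig_inj.
  case=> -[[a b] ab] hab [/= bz]; rewrite /= => as_; subst a.
  apply: sig_inj; apply: sig_inj => /=; congr pair; apply: t_uniq; split=> //.
  by rewrite -bz.
- by move=> n s; rewrite [RHS](proj2_sig (proj1_sig s)).
- move=> u v p _; split=> [->//|[uv1 uv2]]; apply: sig_inj; apply: sig_inj.
  by rewrite [LHS]surjective_pairing [RHS]surjective_pairing; congr pair.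
Qed.

End Pullback.

(* Main.v *)
Require Import Defs.
From mathcomp Require Import all_boot.
From mathcomp Require Import boolp classical_sets functions cardinality.
From Stdlib Require Import Relations.
From Stdlib Require List.

(** The proof rests on imitators. Let [psi : Z -> X] be a local isometry to a
    special complex. A walker moves along the edges of [X], and an imitator
    moves in [Z]: when the walker crosses an edge [e], the imitator crosses the
    edge at its own position whose image is parallel to [e] if there is one, and
    otherwise stays. There is at most one such edge because hyperplanes do not
    self-osculate. Because hyperplanes do not inter-osculate, homotopic walks of
    the walker give homotopic walks of the imitator ([imit_homotopy]). So, when
    [Z] is finite, the walks of [X] after which walker and imitator return to
    their places define a finite cover of [X] ([walk_cover]).

    In this cover [C] the cubes in which a walker that started at the same place
    as the imitator is still with it form an embedded copy of [Z]
    ([pbTracks_tracked]). Whether the imitator moves when the walker crosses an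
    edge depends only on the hyperplane of that edge in [C] ([moved_par]); hence
    this copy does not inter-osculate with hyperplanes ([tracks_par]). Taking
    all the [Y i] at once, the first assertion is thus reduced to embedded
    subcomplexes [A i] of a special complex that do not inter-osculate with its
    hyperplanes.

    For such subcomplexes, let [r i] be the operation that replaces a walk from
    the base point by the walk of its imitator in [A i]. It fixes the walks in
    [A i], and it carries walks in [A j] to walks in [A j] for every [j], since
    an edge that starts in [A j] and crosses a hyperplane that meets [A j] lies
    in [A j] ([retract_stay]). It follows that a composite of the [r i] depends
    only on the last occurrences of its letters ([retracts_undup]), so there are
    finitely many composites. Identify two walks when all composites carry them
    to walks with the same end; this is the cover to use ([intersection_cover]).
    If walks [p i] in [A i], for [i] in [E], end at the same vertex of that
    cover, let [q] be the image of one of them under the composite of all [r i]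
    with [i] in [E]. Then [q] lies in every [A i], and it ends at that vertex
    too: apply a composite [w] to [q] and remove the letters one by one,
    replacing at each letter [i] the walk under it by [p i], which [r i] fixes
    ([sameEnds_inter]).

    For the second assertion the [A i] are subcomplexes of [X], but only a
    finite cover of [X] is special. The imitators then move in a regular special
    cover [W] ([regular_cover]), and the ends of walks are compared up to a deck
    transformation of [W]. A walk that lies in all the [A i] is fixed by every
    composite, so two such walks that end at the same vertex of [X] are
    identified ([sameEnds_all]); this is the injectivity on the intersection. *)

Set Implicit Arguments.
Unset Strict Implicit.
Unset Printing Implicit Defensive.

Local Open Scope classical_set_scope.

(** * Edges and squares of a cube *)

Definition flip n (u : corner n) (i : 'I_n) : corner n :=
  [ffun j => u j (+) (j == i)].

Lemma flipK n (u : corner n) i : flip (flip u i) i = u.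
Proof. by apply/ffunP => j; rewrite !ffunE -addbA addbb addbF. Qed.

Lemma flipC n (u : corner n) i j : flip (flip u i) j = flip (flip u j) i.
Proof. by apply/ffunP => k; rewrite !ffunE addbAC. Qed.

Lemma corner_ind n (P : corner n -> Prop) :
  P (corner0 n) -> (forall u i, P u -> P (flip u i)) -> forall u, P u.
Proof.
move=> P0 PS u; have [k] := ubnP #|[pred i | u i]|; elim: k u => // k IH u hk.
case: (pickP [pred i | u i]) => [i /= ui|u0]; last first.
  suff -> : u = corner0 n by [].
  by apply/ffunP => i; rewrite ffunE; apply: u0.
rewrite -(flipK u i); apply/PS/IH; move: hk.
rewrite (cardD1 i) inE ui add1n ltnS; apply: leq_trans.
rewrite ltnS; apply: subset_leq_card; apply/fintype.subsetP => j.
by rewrite !inE ffunE; case: eqP => [->|_]; rewrite ?ui ?addbF.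
Qed.

Lemma fm_edgeat_subproof n (w : corner n) (i : 'I_n) :
  isometric [ffun c : corner 1 => [ffun j => w j (+) ((j == i) && c ord0)]].
Proof.
apply/isometricP => u v; rewrite !ffunE /hamming big_ord1 (bigD1 i) //=.
rewrite !ffunE eqxx /= big1 ?addn0 => [|j /negPf ji].
  by rewrite (inj_eq (can_inj (addKb _))).
by rewrite !ffunE ji !addbF eqxx.
Qed.
(** Unlike [fm_edge w i], this edge always starts at [w]. *)
Definition fm_edgeat n (w : corner n) (i : 'I_n) : faceMap 1 n :=
  Sub _ (fm_edgeat_subproof w i).

Lemma fm_edgeatP n (g : faceMap 1 n) :
  exists i, g = fm_edgeat (val g (corner0 1)) i.
Proof.
have := isometricP _ (valP g) (corner0 1) (corner1 1).
rewrite /hamming big_ord1 !ffunE /= => h1.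
have [i hi] : exists i, val g (corner0 1) i != val g (corner1 1) i.
  apply/existsP; rewrite -[X in is_true X]negbK negb_exists.
  apply/forallP => h0; move: h1; rewrite big1 // => i _.
  by rewrite (negPf (h0 i)).
exists i; apply: faceMapE => c; rewrite ffunE; apply/ffunP => j; rewrite ffunE.
have hj : j != i -> val g (corner0 1) j = val g (corner1 1) j.
  move=> ji; apply/eqP/negPn/negP => hj.
  by move: h1; rewrite (bigD1 i) //= (bigD1 j) //= hi hj.
case: (boolP (c ord0)) => c0.
  have -> : c = corner1 1 by apply/ffunP => k; rewrite ord1 ffunE c0.
  rewrite andbT; case: eqP => [->|/eqP /hj ->]; last by rewrite addbF.
  by move: hi; case: (val g _ i); case: (val g _ i).
have -> : c = corner0 1 by apply/ffunP => k; rewrite ord1 ffunE (negPf c0).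
by rewrite andbF addbF.
Qed.

Lemma fm_edgeat0 n (w : corner n) i : val (fm_edgeat w i) (corner0 1) = w.
Proof. by apply/ffunP => j; rewrite !ffunE andbF addbF. Qed.

Lemma fm_edgeat1 n (w : corner n) i : val (fm_edgeat w i) (corner1 1) = flip w i.
Proof. by apply/ffunP => j; rewrite !ffunE andbT. Qed.

Lemma fm_squareat_subproof n (w : corner n) (i j : 'I_n) (ij : i != j) :
  isometric [ffun c : corner 2 => [ffun k =>
    w k (+) ((k == i) && c ord0) (+) ((k == j) && c ord_max)]].
Proof.
have ji : (j == i) = false by rewrite eq_sym (negPf ij).
apply/isometricP => u v; rewrite !ffunE /hamming big_ord_recl big_ord1.
rewrite (bigD1 i) //= (bigD1 j) ?ji //= addnA big1 ?addn0.
  rewrite !ffunE !eqxx ji (negPf ij) /= !addbF !(inj_eq (can_inj (addKb _))).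
  by congr (_ + (u _ != v _)); apply: val_inj.
by move=> k /andP[/negPf ki /negPf kj]; rewrite !ffunE ki kj !addbF eqxx.
Qed.
Definition fm_squareat n (w : corner n) (i j : 'I_n) (ij : i != j) : faceMap 2 n :=
  Sub _ (fm_squareat_subproof w ij).

Lemma ord2P (P : 'I_2 -> Prop) : P ord0 -> P ord_max -> forall i, P i.
Proof.
move=> P0 P1 [[|[|//]] hi].
  by have -> : Ordinal hi = ord0 by apply: val_inj.
by have -> : Ordinal hi = ord_max by apply: val_inj.
Qed.

Section CubeFaces.
Variable X : cubeCells.

Definition vtx n (s : X n) (u : corner n) : X 0 := face (fm_vertex u) s.
Definition edgeat n (s : X n) (u : corner n) (i : 'I_n) : X 1 :=
  face (fm_edgeat u i) s.

Lemma vtx_face m n (f : faceMap m n) (s : X n) u :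
  vtx (face f s) u = vtx s (val f u).
Proof.
by rewrite /vtx -face_comp; congr (face _ s); apply: faceMapE => w; rewrite !ffunE.
Qed.

Lemma src_face n (g : faceMap 1 n) (s : X n) :
  src (face g s) = vtx s (val g (corner0 1)).
Proof. exact: vtx_face. Qed.

Lemma tgt_face n (g : faceMap 1 n) (s : X n) :
  tgt (face g s) = vtx s (val g (corner1 1)).
Proof. exact: vtx_face. Qed.

Lemma src_edgeat n (s : X n) u i : src (edgeat s u i) = vtx s u.
Proof. by rewrite src_face fm_edgeat0. Qed.

Lemma tgt_edgeat n (s : X n) u i : tgt (edgeat s u i) = vtx s (flip u i).
Proof. by rewrite tgt_face fm_edgeat1. Qed.

Lemma axisE n (s : X n) i : axis i s = edgeat s (corner0 n) i.
Proof.
congr (face _ s); apply: faceMapE => u; rewrite !ffunE; apply/ffunP => j.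
by rewrite !ffunE; case: eqP.
Qed.

Lemma src_axis n (s : X n) i : src (axis i s) = base s.
Proof. by rewrite axisE src_edgeat. Qed.

Lemma reverse_edgeat n (s : X n) u i :
  reverse (edgeat s u i) = edgeat s (flip u i) i.
Proof.
rewrite /reverse -face_comp; congr (face _ s); apply: faceMapE => w.
rewrite !ffunE; apply/ffunP => j; rewrite !ffunE unlift_none -addbA; congr addb.
by case: eqP.
Qed.

Lemma reverseK (e : X 1) : reverse (reverse e) = e.
Proof.
rewrite -[RHS]face_id /reverse -face_comp; congr (face _ e).
apply: faceMapE => u; rewrite !ffunE /=; apply/ffunP => j.
rewrite ord1 !ffunE. by rewrite !unlift_none negbK.
Qed.

(** The edges of a square from its vertex 00 (the two axes), and the edges
    from 01 and 10 opposite to them. *)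
Definition sqa (q : X 2) : X 1 := axis ord0 q.
Definition sqb (q : X 2) : X 1 := axis ord_max q.
Definition sqa' (q : X 2) : X 1 := face (fm_edge (corner1 2) ord0) q.
Definition sqb' (q : X 2) : X 1 := face (fm_edge (corner1 2) ord_max) q.

Lemma sqa'E q : sqa' q = edgeat q (flip (corner0 2) ord_max) ord0.
Proof.
congr (face _ q); apply: faceMapE => u; rewrite !ffunE; apply/ffunP.
by apply: ord2P; rewrite !ffunE.
Qed.

Lemma sqb'E q : sqb' q = edgeat q (flip (corner0 2) ord0) ord_max.
Proof.
congr (face _ q); apply: faceMapE => u; rewrite !ffunE; apply/ffunP.
by apply: ord2P; rewrite !ffunE.
Qed.

Lemma src_sqa q : src (sqa q) = base q. Proof. exact: src_axis. Qed.
Lemma src_sqb q : src (sqb q) = base q. Proof. exact: src_axis. Qed.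
Lemma src_sqa' q : src (sqa' q) = tgt (sqb q).
Proof. by rewrite sqa'E /sqb axisE src_edgeat tgt_edgeat. Qed.
Lemma src_sqb' q : src (sqb' q) = tgt (sqa q).
Proof. by rewrite sqb'E /sqa axisE src_edgeat tgt_edgeat. Qed.
Lemma tgt_sqa' q : tgt (sqa' q) = tgt (sqb' q).
Proof. by rewrite sqa'E sqb'E !tgt_edgeat flipC. Qed.

Lemma fm_swap_subproof :
  isometric [ffun c : corner 2 => [ffun k : 'I_2 => c (rev_ord k)]].
Proof.
apply/isometricP => u v; rewrite !ffunE /hamming [RHS](reindex_inj rev_ord_inj).
by apply: eq_bigr => k _; rewrite !ffunE.
Qed.
Definition sqswap (q : X 2) : X 2 := face (Sub _ fm_swap_subproof : faceMap 2 2) q.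

Lemma rev_ord2 : (rev_ord (ord0 : 'I_2) = ord_max) * (rev_ord (ord_max : 'I_2) = ord0).
Proof. by split; apply: val_inj. Qed.

Lemma sqswap_edgeat q i :
  edgeat (sqswap q) (corner0 2) i = edgeat q (corner0 2) (rev_ord i).
Proof.
rewrite /sqswap /edgeat -face_comp; congr (face _ q); apply: faceMapE => u.
rewrite !ffunE; apply/ffunP => j; rewrite !ffunE.
by rewrite (can2_eq rev_ordK rev_ordK).
Qed.

Lemma sqswapE q : (sqa (sqswap q) = sqb q) * (sqb (sqswap q) = sqa q)
  * (sqa' (sqswap q) = sqb' q) * (sqb' (sqswap q) = sqa' q).
Proof.
rewrite /sqa /sqb !axisE !sqswap_edgeat !rev_ord2; split; first split=> //.
  rewrite /sqswap /sqa' /sqb' -face_comp; congr (face _ q); apply: faceMapE => u.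
  by rewrite !ffunE; apply/ffunP; apply: ord2P; rewrite !ffunE.
rewrite /sqswap /sqa' /sqb' -face_comp; congr (face _ q); apply: faceMapE => u.
by rewrite !ffunE; apply/ffunP; apply: ord2P; rewrite !ffunE.
Qed.

(** The square seen from its vertex 10. *)
Lemma fm_reflect_subproof :
  isometric [ffun c : corner 2 => flip c ord0].
Proof.
apply/isometricP => u v; rewrite !ffunE /hamming.
apply: eq_bigr => k _; rewrite !ffunE; congr (nat_of_bool (~~ _)).
by rewrite (inj_eq (can_inj (addbK _))).
Qed.
Definition sqflip (q : X 2) : X 2 := face (Sub _ fm_reflect_subproof : faceMap 2 2) q.

Lemma sqflip_edgeat q i :
  edgeat (sqflip q) (corner0 2) i = edgeat q (flip (corner0 2) ord0) i.
Proof.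
rewrite /sqflip /edgeat -face_comp; congr (face _ q); apply: faceMapE => u.
by rewrite !ffunE; apply/ffunP => j; rewrite !ffunE; rewrite addbAC.
Qed.

Lemma sqflipE q : (sqa (sqflip q) = reverse (sqa q)) * (sqb (sqflip q) = sqb' q)
  * (sqb' (sqflip q) = sqb q).
Proof.
rewrite /sqa /sqb !axisE !sqflip_edgeat reverse_edgeat sqb'E; split=> //.
rewrite sqb'E /sqflip /edgeat -face_comp; congr (face _ q); apply: faceMapE => u.
by rewrite !ffunE; apply/ffunP; apply: ord2P; rewrite !ffunE /= ?addbT ?addbF ?negbK.
Qed.

Lemma squareat_edges n (s : X n) u i j : i != j -> exists q : X 2,
  [/\ sqa q = edgeat s u i, sqb q = edgeat s u j,
      sqa' q = edgeat s (flip u j) i & sqb' q = edgeat s (flip u i) j].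
Proof.
move=> ij; exists (face (fm_squareat u ij) s).
by split; rewrite /sqa /sqb ?axisE ?sqa'E ?sqb'E /edgeat -face_comp;
  congr (face _ s); apply: faceMapE => w; rewrite !ffunE; apply/ffunP => k;
  rewrite !ffunE /= ?addbF ?andbT ?andbF ?addbF // addbAC.
Qed.

(** * Parallel edges *)

Lemma par_refl (e : X 1) : parallel e e. Proof. exact: rst_refl. Qed.

Lemma par_sym (e f : X 1) : parallel e f -> parallel f e.
Proof. exact: rst_sym. Qed.

Lemma par_trans (e f g : X 1) : parallel e f -> parallel f g -> parallel e g.
Proof. exact: rst_trans. Qed.

Lemma par_rev (e : X 1) : parallel e (reverse e).
Proof. by apply: rst_step; left; right. Qed.

Lemma par_revl (e f : X 1) : parallel e f -> parallel (reverse e) f.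
Proof. by apply: par_trans; apply/par_sym/par_rev. Qed.

Lemma par_sqa (q : X 2) : parallel (sqa q) (sqa' q).
Proof. by apply: rst_step; right; exists q; split; left. Qed.

Lemma par_sqb (q : X 2) : parallel (sqb q) (sqb' q).
Proof. by have := par_sqa (sqswap q); rewrite !sqswapE. Qed.

(** [parallel] is also generated by reversal and by the opposite sides of squares
    in one direction, which leaves a single square to consider. *)
Lemma par_ind (P : X 1 -> X 1 -> Prop) :
  (forall e, P e e) -> (forall e f, P e f -> P f e) ->
  (forall e f g, P e f -> P f g -> P e g) ->
  (forall e, P e (reverse e)) -> (forall q, P (sqa q) (sqa' q)) ->
  forall e f, parallel e f -> P e f.
Proof.
move=> Pr Ps Pt Prev Psq e f.
have Pse e1 e2 : same_edge e1 e2 -> P e1 e2 by case=> ->.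
elim=> [e1 e2 [/Pse//|[q [/Pse h1 /Pse h2]]]|//|e1 e2 _ /Ps//|e1 e2 e3 _ h1 _].
  by apply: Pt (Pt _ _ _ (Psq q) h2); apply: Ps.
exact: Pt.
Qed.

Lemma hyp_eq (e f : X 1) : parallel e f -> hyp e = hyp f.
Proof.
move=> ef; apply/seteqP; split=> g; rewrite /hyp /=; last exact: par_trans.
by apply: par_trans; apply: par_sym.
Qed.

Lemma hyp_par (e f : X 1) : hyp e = hyp f -> parallel e f.
Proof. by move=> ef; have : hyp f f by [apply: par_refl]; rewrite -ef. Qed.

End CubeFaces.

(** * Walks and covers *)

Section Walks.
Variable X : cubeCells.
Implicit Types (u v w : X 0) (p q : seq (X 1)) (e : X 1).

Lemma walk_catE u p q w :
  walk u (p ++ q) w <-> exists v, walk u p v /\ walk v q w.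
Proof.
split=> [|[v [hp hq]]]; last exact: walk_cat hp hq.
elim: p u => [u h|e p IH u /= [<- /IH[v [hp hq]]]]; first by exists u.
by exists v.
Qed.

Lemma walk_end u p v v' : walk u p v -> walk u p v' -> v = v'.
Proof. by elim: p u => [u /= <-|e p IH u /= [_ /IH h] [_ /h]]. Qed.

Lemma walk_rcons u p e : walk u p (src e) -> walk u (rcons p e) (tgt e).
Proof. by move=> hp; rewrite -cats1; apply: walk_cat hp _. Qed.

Lemma walk_edgeat n (s : X n) a i u p : walk u p (vtx s a) ->
  walk u (rcons p (edgeat s a i)) (vtx s (flip a i)).
Proof. by rewrite -(src_edgeat s a i) -tgt_edgeat; apply: walk_rcons. Qed.

End Walks.

Section MapFaces.
Variables (X Y : cubeCells) (f : cubeMap X Y).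

Lemma map_base n (s : X n) : base (f n s) = f 0 (base s).
Proof. exact: esym (cmap_face _ _ _). Qed.
Lemma map_src (e : X 1) : src (f 1 e) = f 0 (src e).
Proof. exact: esym (cmap_face _ _ _). Qed.
Lemma map_tgt (e : X 1) : tgt (f 1 e) = f 0 (tgt e).
Proof. exact: esym (cmap_face _ _ _). Qed.
Lemma map_axis n (s : X n) i : axis i (f n s) = f 1 (axis i s).
Proof. exact: esym (cmap_face _ _ _). Qed.
Lemma map_reverse (e : X 1) : reverse (f 1 e) = f 1 (reverse e).
Proof. exact: esym (cmap_face _ _ _). Qed.
Lemma map_edgeat n (s : X n) u i : edgeat (f n s) u i = f 1 (edgeat s u i).
Proof. exact: esym (cmap_face _ _ _). Qed.
Lemma map_sq (q : X 2) : (sqa (f 2 q) = f 1 (sqa q)) * (sqb (f 2 q) = f 1 (sqb q))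
  * (sqa' (f 2 q) = f 1 (sqa' q)) * (sqb' (f 2 q) = f 1 (sqb' q)).
Proof. by rewrite /sqa /sqb /sqa' /sqb' /axis -!cmap_face. Qed.

Lemma map_walk u p v : walk u p v -> walk (f 0 u) (map (f 1) p) (f 0 v).
Proof.
elim: p u => [u /= ->//|e p IH u /= [<- /IH]].
by rewrite map_src map_tgt.
Qed.

Lemma map_par (e e' : X 1) : parallel e e' -> parallel (f 1 e) (f 1 e').
Proof.
elim/par_ind=> [e0|e0 f0|e0 f0 g0 h1|e0|q].
- exact: par_refl.
- exact: par_sym.
- exact: par_trans h1.
- by rewrite -map_reverse; apply: par_rev.
- by have := par_sqa (f 2 q); rewrite !map_sq.
Qed.

End MapFaces.

Definition cmap_id (X : cubeCells) : cubeMap X X :=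
  @CubeMap X X (fun n s => s) (fun m n f s => erefl).

Lemma cmap_comp_subproof (X Y Z : cubeCells) (g : cubeMap Y Z) (f : cubeMap X Y)
  m n (h : faceMap m n) (s : X n) : g m (f m (face h s)) = face h (g n (f n s)).
Proof. by rewrite !cmap_face. Qed.
Definition cmap_comp (X Y Z : cubeCells) (g : cubeMap Y Z) (f : cubeMap X Y) :
  cubeMap X Z := CubeMap (cmap_comp_subproof g f).

Lemma fm_xor_subproof n (w : corner n) :
  isometric [ffun c : corner n => [ffun j => w j (+) c j]].
Proof.
apply/isometricP => u v; rewrite !ffunE /hamming; apply: eq_bigr => k _.
by rewrite !ffunE (inj_eq (can_inj (addKb _))).
Qed.
Definition fm_xor n (w : corner n) : faceMap n n := Sub _ (fm_xor_subproof w).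

Lemma fm_xorK (X : cubeCells) n (w : corner n) (s : X n) :
  face (fm_xor w) (face (fm_xor w) s) = s.
Proof.
rewrite -[RHS]face_id -face_comp; congr (face _ s); apply: faceMapE => u.
by rewrite !ffunE; apply/ffunP => j; rewrite !ffunE addbA addbb.
Qed.

Lemma base_xor (X : cubeCells) n (w : corner n) (s : X n) :
  base (face (fm_xor w) s) = vtx s w.
Proof.
rewrite base_face; congr (face (fm_vertex _) s).
by apply/ffunP => j; rewrite !ffunE addbF.
Qed.

Section Coverings.
Variables (X Y : cubeCells) (f : cubeMap Y X).
Hypothesis f_cov : covering f.

Lemma cov_uniq n (s t : Y n) : base s = base t -> f n s = f n t -> s = t.
Proof.
move=> st fst; have [t0 [_ h]] := f_cov (map_base f s).
by rewrite -(h s) // -(h t) // st fst.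
Qed.

Lemma cov_lift n (s : X n) y : base s = f 0 y -> exists t, base t = y /\ f n t = s.
Proof. by move=> /f_cov[t [h _]]; exists t. Qed.

(** A reflection of the cube moves any vertex to the base, so a covering lifts a
    cube uniquely from the lift of any one of its faces. *)
Lemma cov_face_uniq m n (g : faceMap m n) (s t : Y n) :
  face g s = face g t -> f n s = f n t -> s = t.
Proof.
move=> st fst; pose w := val g (corner0 m).
rewrite -(fm_xorK w s) -(fm_xorK w t); congr face.
apply: cov_uniq; last by rewrite !cmap_face fst.
have vw r : vtx r w = base (face g r) by rewrite base_face.
by rewrite !base_xor !vw st.
Qed.

Lemma cov_face_lift m n (g : faceMap m n) (s : X n) (t : Y m) :
  f m t = face g s -> exists t', face g t' = t /\ f n t' = s.
Proof.
move=> fts; pose w := val g (corner0 m).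
have h : base (face (fm_xor w) s) = f 0 (base t).
  by rewrite base_xor -map_base fts base_face.
have [t1 [bt1 ft1]] := cov_lift h.
have ft' : f n (face (fm_xor w) t1) = s by rewrite cmap_face ft1 fm_xorK.
exists (face (fm_xor w) t1); split=> //; apply: cov_uniq.
  by rewrite base_face -/w -/(vtx _ _) -base_xor fm_xorK.
by rewrite cmap_face ft' fts.
Qed.

Lemma walk_lift u p v : walk (f 0 u) p v ->
  exists P v', [/\ walk u P v', map (f 1) P = p & f 0 v' = v].
Proof.
elim: p u => [u /= <-|e p IH u /= [su hp]]; first by exists [::], u.
have [e' [se' fe']] := cov_lift su.
move: hp; rewrite -fe' map_tgt => /IH[P [v' [hP <- <-]]].
by exists (e' :: P), v'; split=> //=.
Qed.

Lemma walk_lift_uniq u P P' v v' : walk u P v -> walk u P' v' ->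
  map (f 1) P = map (f 1) P' -> P = P'.
Proof.
elim: P P' u => [[]//|e P IH [//|e' P'] u /= [se hP] [se' hP'] [ee PP']].
have h : e = e' by apply: cov_uniq ee; apply: etrans se (esym se').
by rewrite h in hP *; rewrite (IH _ _ hP hP').
Qed.

End Coverings.

Lemma covering_surj (X Y : cubeComplex) (f : cubeMap Y X) :
  covering f -> forall x, exists y, f 0 y = x.
Proof.
move=> f_cov x; have [[y _] _] := cells_connected Y.
have [_ /(_ (f 0 y) x)[//|//|p [hp _]]] := cells_connected X.
by have [P [y' [_ _ <-]]] := walk_lift f_cov hp; exists y'.
Qed.

Lemma covering_comp (X Y Z : cubeCells) (g : cubeMap Y Z) (f : cubeMap X Y) :
  covering g -> covering f -> covering (cmap_comp g f).
Proof.
move=> g_cov f_cov x n s sx.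
have [t [bt gt]] := cov_lift g_cov sx; have [r [br fr]] := cov_lift f_cov bt.
exists r; split=> [|r' [br' /= gr']]; first by split=> //=; rewrite fr.
apply: (cov_uniq f_cov); first by rewrite br br'.
by apply: (cov_uniq g_cov); rewrite ?map_base ?br ?br' // gr' fr.
Qed.

Lemma finite_sheeted_comp (X Y Z : cubeCells) (g : cubeMap Y Z) (f : cubeMap X Y) :
  finite_sheeted g -> finite_sheeted f -> finite_sheeted (cmap_comp g f).
Proof.
move=> g_fin f_fin z; pose F y := [set x | f 0 x = y].
have : finite_set (\bigcup_(y in [set y | g 0 y = z]) F y).
  by apply: bigcup_finite => // y _; apply: f_fin.
by apply: sub_finite_set => x /= gx; exists (f 0 x).
Qed.

Lemma finite_cover (X Y : cubeCells) (f : cubeMap Y X) :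
  finite_set [set: X 0] -> finite_sheeted f -> finite_set [set: Y 0].
Proof.
move=> X_fin f_fin; pose F x := [set y | f 0 y = x].
have : finite_set (\bigcup_(x in [set: X 0]) F x).
  by apply: bigcup_finite => // y _; apply: f_fin.
by apply: sub_finite_set => y _; exists (f 0 y).
Qed.

Lemma finite_vertices (X : cubeComplex) : finite_complex X -> finite_set [set: X 0].
Proof.
move=> X_fin; pose g (v : X 0) : {n & X n} := existT _ 0 v.
apply: (@sub_finite_set _ _ (g @^-1` [set: {n & X n}])) => //.
apply: finite_preimage => // u v _ _; exact: existT_inj2.
Qed.

(** * Special complexes *)

(** The two consequences of direct specialness on which imitation depends: at a
    vertex an edge is determined by its hyperplane, and whether two edges at a
    vertex span a square is determined by their hyperplanes.  Unlike direct
    specialness, they pass to covers at once. *)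
Definition special (X : cubeCells) : Prop :=
  (forall e f : X 1, src e = src f -> parallel e f -> e = f) /\
  (forall (q : X 2) (a b : X 1), parallel (sqa q) a -> parallel (sqb q) b ->
     src a = src b -> exists q', [/\ base q' = src a, sqa q' = a & sqb q' = b]).

(** A second edge at [src e] parallel to [e] would form a corner of a square with
    [e], hence a self-intersection, or else a self-osculation.  Edges parallel to
    the sides of a square that did not span a square would make the two distinct
    intersecting hyperplanes osculate. *)
Lemma directly_special_special (X : cubeCells) : directly_special X -> special X.
Proof.
move=> [X_npc X_spec].
have hypP (e : X 1) : hyperplane (hyp e) by exists e.
have noloop (e : X 1) : src e <> tgt e.
  by move=> h; have [_ _ so _] := X_spec _ (hypP e);
    apply: so; right; exists e.
have sp1 (e f : X 1) : src e = src f -> parallel e f -> e = f.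
  move=> ef par_ef; have [_ si so _] := X_spec _ (hypP e).
  apply: contrapT => nef.
  have nse : ~ same_edge e f.
    by case=> [/esym//|fe]; apply: (noloop e); rewrite {1}ef fe src_reverse.
  case: (pselect (square_corner e f (src e))) => sc.
    by apply: si; exists e, f, (src e); split=> //; [apply: hyp_eq|split; left].
  by apply: so; left; exists e, f, (src e); split=> //; [apply: hyp_eq|split; left].
split=> // q a b qa qb ab.
have qab : ~ parallel (sqa q) (sqb q).
  have [[inj _] _] := X_npc (base q) => par_ab.
  have /(inj 2 q erefl) // : sqa q = sqb q.
  by apply: sp1 par_ab; rewrite src_sqa src_sqb.
have nse : ~ same_edge a b.
  move=> s_ab; apply: qab; apply: par_trans qa _; apply: par_trans (par_sym qb).
  by case: s_ab => ->; [apply: par_refl|apply: par_rev].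
have [_ _ _ /(_ _ (hypP (sqb q))) io] :=
  X_spec _ (hypP (sqa q)).
have [sc|sc] := pselect (square_corner a b (src a)); last first.
  case: io; split; first by move/hyp_par.
    exists (sqa q), (sqb q), (base q); split=> //.
    - by case=> h; apply: qab; rewrite h; [apply: par_refl|apply: par_rev].
    - by split; left; rewrite ?src_sqa ?src_sqb.
    - by exists q; split=> //; left.
  by exists a, b, (src a); split; rewrite ?(hyp_eq qa) ?(hyp_eq qb) //;
    split; left.
have same_src (c d : X 1) : same_edge c d -> src c = src d -> c = d.
  by case=> -> //; rewrite src_reverse => /noloop.
case: sc => q' [bq' sa sb]; exists q'; split=> //; apply: same_src => //.
  by rewrite src_sqa.
by rewrite src_sqb -ab.
Qed.

Lemma special_cover (X Y : cubeCells) (f : cubeMap Y X) :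
  covering f -> special X -> special Y.
Proof.
move=> f_cov [sp1 sp2]; split=> [e e' ee' /(map_par f) par_ee'|q a b qa qb ab].
  by apply: (cov_uniq f_cov) => //; apply: sp1 par_ee'; rewrite !map_src ee'.
have := sp2 (f 2 q) (f 1 a) (f 1 b); rewrite !map_sq !map_src ab.
case=> // [||q' [bq' qa' qb']]; try exact: map_par.
have [Q [bQ fQ]] := cov_lift f_cov bq'.
exists Q; split=> //; apply: (cov_uniq f_cov).
- by rewrite [LHS]src_sqa bQ.
- by rewrite -(map_sq f) fQ.
- by rewrite [LHS]src_sqb bQ.
- by rewrite -(map_sq f) fQ.
Qed.

(** * Elementary homotopies *)

(** One elementary move, in the directions that turn walks into walks: inserting
    a backtrack at a wrong place would not. *)
Inductive homotopy (X : cubeCells) : seq (X 1) -> seq (X 1) -> Prop :=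
| Homotopy_refl p : homotopy p p
| Homotopy_back a e b : homotopy (a ++ [:: e, reverse e & b]) (a ++ b)
| Homotopy_square a q b :
    homotopy (a ++ [:: sqa q, sqb' q & b]) (a ++ [:: sqb q, sqa' q & b]).

Section HomotopyWalk.
Variables (X : cubeCells).

Lemma homotopy_walk (u v : X 0) p p' : homotopy p p' -> walk u p v -> walk u p' v.
Proof.
case=> // [a e b|a q b] /walk_catE[w [ha]] /= [ew [_ hb]]; apply: walk_cat ha _.
  by rewrite -ew -tgt_reverse.
by rewrite /= src_sqb src_sqa' tgt_sqa' -ew src_sqa.
Qed.

Lemma homotopy_cat (a b p p' : seq (X 1)) :
  homotopy p p' -> homotopy (a ++ p ++ b) (a ++ p' ++ b).
Proof.
case=> [r|r e r'|r q r']; first exact: Homotopy_refl.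
  by rewrite -!catA !(catA a); apply: Homotopy_back.
by rewrite -!catA !(catA a); apply: Homotopy_square.
Qed.

Lemma homotopy_map (Y : cubeCells) (f : cubeMap X Y) p p' :
  homotopy p p' -> homotopy (map (f 1) p) (map (f 1) p').
Proof.
case=> [r|a e b|a q b]; first exact: Homotopy_refl.
  by rewrite !map_cat /= -map_reverse; apply: Homotopy_back.
by rewrite !map_cat /= -!map_sq; apply: Homotopy_square.
Qed.

End HomotopyWalk.

(** * Imitators *)

Section Imitator.
Variables (X Z : cubeCells) (psi : cubeMap Z X).
Implicit Types (z : Z 0) (e : X 1) (f g : Z 1) (p : seq (X 1)).

(** Hyperplanes are compared without orientation.  Otherwise an imitator that
    stays when [e] is crossed could move when the walker returns across [e]. *)
Definition follows z e f : Prop := src f = z /\ parallel e (psi 1 f).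

Definition imitEdge z e : option (Z 1) :=
  if pselect (exists f, follows z e f) is left h then Some (proj1_sig (cid h))
  else None.

Fixpoint imit z p : seq (Z 1) :=
  if p is e :: p' then
    if imitEdge z e is Some f then f :: imit (tgt f) p' else imit z p'
  else [::].

Definition imitStep z e : Z 0 := if imitEdge z e is Some f then tgt f else z.

Definition imitEnd z p : Z 0 := foldl imitStep z p.

Variant imitEdge_spec z e : option (Z 1) -> Prop :=
| ImitEdgeSome f : follows z e f -> imitEdge_spec z e (Some f)
| ImitEdgeNone : (forall f, ~ follows z e f) -> imitEdge_spec z e None.

Lemma imitEdgeP z e : imitEdge_spec z e (imitEdge z e).
Proof.
rewrite /imitEdge; case: pselect => [h|h]; constructor.
  exact: (proj2_sig (cid h)).
by move=> f hf; apply: h; exists f.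
Qed.

Lemma imit_walk z p : walk z (imit z p) (imitEnd z p).
Proof.
elim: p z => [//|e p IH] z; rewrite /= /imitStep.
by case: imitEdgeP => //= f [-> _].
Qed.

Lemma imit_cat z p p' : imit z (p ++ p') = imit z p ++ imit (imitEnd z p) p'.
Proof.
elim: p z => [//|e p IH] z; rewrite /= /imitStep.
by case: (imitEdge z e) => [f|]; rewrite IH.
Qed.

Hypothesis X_special : special X.
Hypothesis psi_isom : local_isometry psi.

Lemma follows_edge z e f : src f = z -> psi 1 f = e -> follows z e f.
Proof. by move=> fz <-; split=> //; apply: par_refl. Qed.

Lemma follows_uniq z e f g : follows z e f -> follows z e g -> f = g.
Proof.
case=> fz ef [gz eg]; have [/(_ 1) inj _] := psi_isom z; apply: inj => //.
apply: (proj1 X_special); first by rewrite !map_src fz gz.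
exact: par_trans (par_sym ef) eg.
Qed.

Lemma imitEdge_some z e f : follows z e f -> imitEdge z e = Some f.
Proof.
move=> h; case: imitEdgeP => [g hg|/(_ f)//].
by rewrite (follows_uniq h hg).
Qed.

Lemma imitEdge_none z e : (forall f, ~ follows z e f) -> imitEdge z e = None.
Proof. by move=> h; case: imitEdgeP => // f /h. Qed.

Lemma follows_rev z e f : follows z e f -> follows (tgt f) (reverse e) (reverse f).
Proof.
case=> fz ef; split; first by rewrite src_reverse.
by apply: par_revl; rewrite -map_reverse; apply: par_trans ef (par_rev _).
Qed.

Lemma follows_par z e e' f : parallel e e' -> follows z e f -> follows z e' f.
Proof. by move=> ee' [fz ef]; split=> //; apply: par_trans (par_sym ee') ef. Qed.

(** Edges of [Z] whose images are parallel to the sides of a square span a square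
    in [X] because [X] is special, and in [Z] because links of [Z] are full. *)
Lemma follows_square z (q : X 2) f g :
  follows z (sqa q) f -> follows z (sqb q) g ->
  exists t : Z 2, sqa t = f /\ sqb t = g.
Proof.
case=> fz qf [gz qg].
have [|q' [bq' q'f q'g]] := (proj2 X_special) q _ _ qf qg.
  by rewrite !map_src fz gz.
have bq'z : base q' = psi 0 z by rewrite bq' map_src fz.
have [|t [bt pt]] := (proj2 (psi_isom z)) 2 q' bq'z.
  by apply: ord2P; [exists f|exists g].
have [inj _] := psi_isom z.
exists t; split; apply: (inj 1) => //.
- by rewrite [LHS]src_sqa.
- by rewrite -(map_sq psi) pt.
- by rewrite [LHS]src_sqb.
- by rewrite -(map_sq psi) pt.
Qed.

Lemma follows_sqa z (q : X 2) f :
  follows z (sqa q) f ->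
  exists f', follows (imitStep z (sqb q)) (sqa' q) f'.
Proof.
move=> hf; rewrite /imitStep; case: imitEdgeP => [g hg|_].
  have [t [tf tg]] := follows_square hf hg.
  exists (sqa' t); split; first by rewrite src_sqa' tg.
  apply: par_trans (par_sym (par_sqa q)) _; apply: par_trans (proj2 hf) _.
  by apply: map_par; rewrite -tf; apply: par_sqa.
exists f; exact: follows_par (par_sqa q) hf.
Qed.

(** If the imitator crosses [g] along with [sqb q], then [f] and the reverse of [g]
    follow two sides of the square [q] seen from its vertex 01, so they span a
    square of [Z], whose remaining side at [z] follows [sqa q]. *)
Lemma follows_sqa_inv z (q : X 2) f :
  follows (imitStep z (sqb q)) (sqa' q) f -> exists f', follows z (sqa q) f'.
Proof.
move=> hf; rewrite /imitStep in hf; move: hf; case: imitEdgeP => [g hg|_] hf.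
  pose r := sqflip (sqswap q).
  have [ra rb] : sqa r = reverse (sqb q) /\ sqb r = sqa' q.
    by rewrite !sqflipE !sqswapE.
  have [||t [tg tf]] := @follows_square (tgt g) r (reverse g) f.
  - by rewrite ra; exact: follows_rev hg.
  - by rewrite rb.
  exists (sqb' t); split.
    by rewrite src_sqb' tg tgt_reverse; case: hg.
  apply: par_trans (par_sqa q) _; apply: par_trans (proj2 hf) _.
  by apply: map_par; rewrite -tf; apply: par_sqb.
exists f; exact: follows_par (par_sym (par_sqa q)) hf.
Qed.

(** By [follows_sqa] and [follows_sqa_inv] the imitator crosses each of the two
    hyperplanes on one way round the square if and only if it does on the other;
    if it crosses both, then it goes round a square as well. *)
Lemma imit_square z (q : X 2) p :
  homotopy (imit z [:: sqa q, sqb' q & p]) (imit z [:: sqb q, sqa' q & p]).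
Proof.
have := @follows_sqa z q; have := @follows_sqa_inv z q.
have := @follows_sqa z (sqswap q); have := @follows_sqa_inv z (sqswap q).
rewrite !sqswapE /= /imitStep.
case: (imitEdgeP z (sqa q)) => [f hf|nf]; case: (imitEdgeP z (sqb q)) => [g hg|ng].
- move=> _ _ _ _; have [t [tf tg]] := follows_square hf hg.
  rewrite (@imitEdge_some (tgt f) _ (sqb' t)) 1?(@imitEdge_some (tgt g) _ (sqa' t)).
  + by rewrite -tf -tg tgt_sqa'; apply: (@Homotopy_square _ [::]).
  + split; first by rewrite src_sqa' tg.
    apply: par_trans (par_sym (par_sqa q)) _; apply: par_trans (proj2 hf) _.
    by rewrite -tf; apply: map_par; apply: par_sqa.
  + split; first by rewrite src_sqb' tf.
    apply: par_trans (par_sym (par_sqb q)) _; apply: par_trans (proj2 hg) _.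
    by rewrite -tg; apply: map_par; apply: par_sqb.
- move=> h _ _ _; rewrite (@imitEdge_none (tgt f)); last first.
    by move=> g /h[g' /ng].
  rewrite (@imitEdge_some z _ f); first exact: Homotopy_refl.
  exact: follows_par (par_sqa q) hf.
- move=> _ _ h _; rewrite (@imitEdge_none (tgt g)); last first.
    by move=> f /h[f' /nf].
  rewrite (@imitEdge_some z _ g); first exact: Homotopy_refl.
  exact: follows_par (par_sqb q) hg.
- move=> h _ h' _; rewrite !imitEdge_none; first exact: Homotopy_refl.
    by move=> f /h'[f' /nf].
  by move=> g /h[g' /ng].
Qed.

Lemma imit_homotopy z p p' : homotopy p p' -> homotopy (imit z p) (imit z p').
Proof.
case=> [r|a e b|a q b]; first exact: Homotopy_refl.
  rewrite !imit_cat -{1}[imit z a]cat0s -[imit z a]cat0s /=.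
  set w := imitEnd z a; case: imitEdgeP => [f hf|nf].
    by rewrite (imitEdge_some (follows_rev hf)) tgt_reverse (proj1 hf);
      apply: Homotopy_back.
  rewrite imitEdge_none; first exact: Homotopy_refl.
  by move=> f /(follows_par (par_sym (par_rev e))) /nf.
rewrite !imit_cat; have := homotopy_cat (imit z a) [::] (imit_square (imitEnd z a) q b).
by rewrite !cats0.
Qed.

(** At the start of an edge no other edge is parallel to it, so a walker in [Z]
    takes along an imitator that starts at the same place. *)
Lemma imit_exact z q z' : walk z q z' -> imit z (map (psi 1) q) = q.
Proof.
elim: q z => [//|f q IH] z /= [fz /IH hq].
by rewrite (imitEdge_some (follows_edge fz erefl)) hq.
Qed.

Lemma imitEnd_homotopy z p p' : homotopy p p' -> imitEnd z p = imitEnd z p'.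
Proof.
move=> /(imit_homotopy z)/homotopy_walk/(_ (imit_walk z p)) h.
exact: walk_end h (imit_walk z p').
Qed.

End Imitator.

(** * Finiteness *)

Lemma finite_inj (V : Type) (T : finType) (A : set V) (f : V -> T) :
  (forall u v, A u -> A v -> f u = f v -> u = v) -> finite_set A.
Proof.
move=> f_inj; have h : {in A &, injective f}.
  by move=> u v; rewrite !inE => Au Av; apply: f_inj.
by rewrite -(eq_finite_set (inj_card_eq h)); apply: finite_finset.
Qed.

Lemma finite_code (V : Type) : finite_set [set: V] ->
  exists (T : finType) (f : V -> T), injective f.
Proof.
move=> /finite_set_leP[k /pcard_leP[f]].
have hf v : f v < k by have : `I_k (f v) by apply: funS.
exists 'I_k, (fun v => Ordinal (hf v)) => u v [uv].
by apply: (inj (f := f)) uv; rewrite inE.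
Qed.

(** * Covers from equivalence relations on walks *)

Section WalkCover.
Variables (X : cubeComplex) (x : X 0) (R : seq (X 1) -> seq (X 1) -> Prop).
Hypothesis R_sym : forall p p', R p p' -> R p' p.
Hypothesis R_trans : forall p p' p'', R p p' -> R p' p'' -> R p p''.
Hypothesis R_end : forall p p' v v',
  walk x p v -> walk x p' v' -> R p p' -> v = v'.
Hypothesis R_homotopy : forall p p' v, walk x p v -> homotopy p p' -> R p p'.
Hypothesis R_rcons : forall p p' e,
  walk x p (src e) -> walk x p' (src e) -> R p p' -> R (rcons p e) (rcons p' e).

Let R_refl p v : walk x p v -> R p p.
Proof. by move=> hp; apply: R_homotopy hp (Homotopy_refl p). Qed.

Definition walkClass p : set (seq (X 1)) :=
  [set p' | (exists v, walk x p' v) /\ R p p'].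

Lemma walkClassP p p' v : walk x p' v -> walkClass p p' -> walkClass p = walkClass p'.
Proof.
move=> hp' [_ pp']; apply/seteqP; split=> r [hr pr]; split=> //.
  exact: R_trans (R_sym pp') pr.
exact: R_trans pp' pr.
Qed.

Lemma walkClass_refl p v : walk x p v -> walkClass p p.
Proof. by move=> hp; split; [exists v|apply: R_refl hp]. Qed.

Lemma walkClass_end p p' v : walk x p v -> walkClass p p' -> walk x p' v.
Proof. by move=> hp [[v' hp'] pp']; rewrite (R_end hp hp' pp'). Qed.

(** A cell over [s] assigns to every corner of [s] a class of walks that end there,
    compatibly with the edges of [s].  With one class for every corner, rather
    than for the base only, faces are restrictions and the face identities hold
    trivially. *)
Definition walkCellOk n (sa : X n * (corner n -> set (seq (X 1)))) : Prop :=
  (forall u, exists p, walk x p (vtx sa.1 u) /\ sa.2 u = walkClass p) /\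
  (forall (g : faceMap 1 n) p, sa.2 (val g (corner0 1)) p ->
     sa.2 (val g (corner1 1)) (rcons p (face g sa.1))).

Definition walkCell n := {sa | walkCellOk (n := n) sa}.

Lemma walkCell_face_subproof m n (f : faceMap m n) (s : walkCell n) :
  walkCellOk (face f (proj1_sig s).1, fun u => (proj1_sig s).2 (val f u)).
Proof.
case: s => -[s a] [h1 h2]; split=> /= [u|g p].
  by rewrite vtx_face; apply: h1.
have := h2 (fm_comp f g) p; rewrite /= !ffunE face_comp; exact.
Qed.

Definition walkCell_face m n (f : faceMap m n) (s : walkCell n) : walkCell m :=
  exist (walkCellOk (n := m)) _ (walkCell_face_subproof f s).

Lemma walkCell_face_id n (s : walkCell n) : walkCell_face (fm_id n) s = s.
Proof.
apply: sig_inj; case: s => -[s a] h /=; rewrite face_id; congr pair.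
by apply/funext => u; rewrite ffunE.
Qed.

Lemma walkCell_face_comp l m n (g : faceMap m n) (f : faceMap l m) (s : walkCell n) :
  walkCell_face (fm_comp g f) s = walkCell_face f (walkCell_face g s).
Proof.
apply: sig_inj; case: s => -[s a] h /=; rewrite face_comp; congr pair.
by apply/funext => u; rewrite ffunE.
Qed.

Lemma walkCell_face_free n (f : faceMap n n) (s : walkCell n) :
  walkCell_face f s = s -> f = fm_id n.
Proof. by move/(congr1 (fun s => (proj1_sig s).1)); apply: face_free. Qed.

Definition walkCells :=
  CubeCells walkCell_face_id walkCell_face_comp walkCell_face_free.

Definition walkProj : cubeMap walkCells X :=
  @CubeMap walkCells X (fun n s => (proj1_sig s).1) (fun m n f s => erefl).

Definition clsOf (c : walkCells 0) : set (seq (X 1)) := (proj1_sig c).2 (corner0 0).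

Lemma corner_0 (u : corner 0) : u = corner0 0.
Proof. by apply/ffunP => -[]. Qed.

Lemma vtx_vertex (v : X 0) u : vtx v u = v.
Proof. by rewrite (corner_0 u); apply: base_vertex. Qed.

Lemma clsOfP c : exists p, walk x p (walkProj 0 c) /\ clsOf c = walkClass p.
Proof.
case: c => -[v a] [h1 h2] /=; have [p [hp ap]] := h1 (corner0 0).
by exists p; split=> //; rewrite vtx_vertex in hp.
Qed.

Lemma walkVertex_eq (c c' : walkCells 0) p :
  walkProj 0 c = walkProj 0 c' -> clsOf c p -> clsOf c' p -> c = c'.
Proof.
move=> cc' cp c'p.
have ecls : clsOf c = clsOf c'.
  have [q [hq cq]] := clsOfP c; have [q' [hq' c'q']] := clsOfP c'.
  rewrite cq in cp *; rewrite c'q' in c'p *.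
  have hp := walkClass_end hq cp.
  by rewrite (walkClassP hp cp) (walkClassP hp c'p).
apply: sig_inj; rewrite [LHS]surjective_pairing [RHS]surjective_pairing.
congr pair => //; apply/funext => u; rewrite (corner_0 u); exact: ecls.
Qed.

Lemma clsOf_vtx n (s : walkCells n) u : clsOf (vtx s u) = (proj1_sig s).2 u.
Proof. by rewrite /clsOf /= ffunE. Qed.

Lemma clsOf_walk (c c' : walkCells 0) P p : walk c P c' -> clsOf c p ->
  clsOf c' (p ++ map (walkProj 1) P).
Proof.
elim: P c p => [c p /= -> //|t P IH c p /= [<- hP] cp]; first by rewrite cats0.
rewrite -cat_rcons; apply: IH hP _; move: cp.
rewrite !clsOf_vtx; have := (proj2 (proj2_sig t)) (fm_id 1) p.
by rewrite !ffunE face_id; apply.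
Qed.

(** The 1-skeleton of a cube is simply connected by squares: a walk to the base
    extends to walks to all the corners that are compatible up to [R] with every
    edge of the cube. *)
Lemma coherent_walks n (s : X n) p0 : walk x p0 (base s) ->
  exists a : corner n -> seq (X 1), a (corner0 n) = p0 /\
    forall u, walk x (a u) (vtx s u) /\
      forall i, R (rcons (a u) (edgeat s u i)) (a (flip u i)).
Proof.
move=> hp0; pose below k (u : corner n) := forall i : 'I_n, k <= i -> u i = false.
(* The coordinates of the cube are crossed in increasing order; [k] bounds the
   directions that have been dealt with. *)
suff : forall k, k <= n -> exists a : corner n -> seq (X 1), a (corner0 n) = p0 /\
    forall u, below k u -> walk x (a u) (vtx s u) /\
      forall i : 'I_n, i < k -> R (rcons (a u) (edgeat s u i)) (a (flip u i)).
  case/(_ n (leqnn n)) => a [a0 ha]; exists a; split=> // u.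
  have [|? h] := ha u; first by move=> i; rewrite leqNgt ltn_ord.
  by split=> // i; apply: h.
elim=> [_|k IH kn].
  exists (fun=> p0); split=> // u u0; split=> //.
  by have -> : u = corner0 n by apply/ffunP => i; rewrite ffunE; apply: u0.
have [a [a0 ha]] := IH (ltnW kn); pose j := Ordinal kn.
exists (fun u : corner n => if u j then rcons (a (flip u j)) (edgeat s (flip u j) j) else a u).
split=> [|u hu]; first by rewrite ffunE.
have hb (w : corner n) : below k.+1 w -> w j = false -> below k w.
  move=> hw wj i; rewrite leq_eqVlt => /orP[/eqP ki|/hw//].
  by rewrite -wj; congr (w _); apply: val_inj.
have hflip (w : corner n) : below k.+1 w -> w j -> below k (flip w j).
  move=> hw wj; apply: hb => [i ki|]; rewrite ffunE ?eqxx ?wj // hw //.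
  by case: eqP => // ij; rewrite ij ltnn in ki.
have hw (w : corner n) : below k.+1 w -> walk x
    (if w j then rcons (a (flip w j)) (edgeat s (flip w j) j) else a w) (vtx s w).
  move=> hw; case: ifP => wj; last by apply: (proj1 (ha _ (hb _ hw wj))).
  by have := walk_edgeat j (proj1 (ha _ (hflip _ hw wj))); rewrite flipK.
split=> [|i]; first exact: hw.
have back q (w : corner n) l : walk x q (vtx s w) ->
    R (rcons (rcons q (edgeat s w l)) (edgeat s (flip w l) l)) q.
  move=> hq; apply: R_homotopy (walk_edgeat l (walk_edgeat l hq)) _.
  have := Homotopy_back q (edgeat s w l) [::].
  by rewrite reverse_edgeat cats0 -!cats1 -catA.
rewrite ltnS leq_eqVlt => /orP[/eqP ik|ik].
  have {i ik} -> : i = j by apply: val_inj.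
  rewrite [flip u j j]ffunE eqxx addbT; case: ifP => uj /=; last first.
    rewrite flipK; apply: R_refl (walk_edgeat j _).
    by have := hw u hu; rewrite uj.
  have := back (a (flip u j)) (flip u j) j; rewrite flipK; apply.
  by apply: (proj1 (ha _ (hflip _ hu uj))).
have ij : (j == i) = false by apply/eqP => ij; rewrite -ij ltnn in ik.
have uji : flip u i j = u j by rewrite ffunE ij addbF.
rewrite uji; case: ifP => uj; last by apply: (proj2 (ha _ (hb _ hu uj))).
(* Direction [j] comes last, so it has to be moved past direction [i]: the walks
   are compared across the square that the two span at [flip u j]. *)
have [hwalk hR] := ha _ (hflip _ hu uj).
rewrite flipC.
have hwi := walk_edgeat i hwalk.
apply: R_trans (R_rcons _ _ (hR i ik)); last 2 first.
- by rewrite src_edgeat.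
- rewrite src_edgeat; apply: (proj1 (ha _ _)) => l kl; rewrite ffunE.
  rewrite (hflip _ hu uj _ kl); apply/eqP => li.
  by rewrite li leqNgt ik in kl.
have [q [qa qb qa' qb']] := squareat_edges s (flip u j) (negbT ij).
have := walk_edgeat i (walk_edgeat j hwalk); rewrite flipK => /R_homotopy; apply.
rewrite flipK in qb'.
rewrite -!cats1 -!catA -qa -qb -qa' -qb' /=; exact: Homotopy_square.
Qed.

Lemma walkProj_covering : covering walkProj.
Proof.
move=> c n s sc; have [p [hp cp]] := clsOfP c; rewrite -sc in hp.
have [a [a0 ha]] := coherent_walks hp.
have ok : walkCellOk (s, fun u => walkClass (a u)).
  split=> [u|g r] /=; first by exists (a u); split=> //; case: (ha u).
  have [i gi] := fm_edgeatP g; rewrite gi fm_edgeat0 fm_edgeat1 -gi => hr.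
  set u := val g _ in hr *; have [hu hui] := ha u.
  have hr' := walkClass_end hu hr; have er : src (face g s) = vtx s u by rewrite src_face.
  split; first by exists (tgt (face g s)); apply: walk_rcons; rewrite er.
  apply: R_trans (R_sym (hui i)) _; rewrite /edgeat -gi.
  by apply: R_rcons; rewrite ?er //; case: hr.
have bp : clsOf c p by rewrite cp; apply: walkClass_refl hp.
exists (exist (walkCellOk (n := n)) _ ok); split.
  split=> //; apply: (@walkVertex_eq _ _ p) => //.
  by rewrite [clsOf _](clsOf_vtx (n := n)) /= a0; apply: walkClass_refl hp.
case=> -[s' b] [ok1 ok2] /= [bc es]; subst s'.
apply: sig_inj => /=; congr pair; apply/funext => /= u.
have [q [qa qb]] : exists q, walkClass (a u) q /\ b u q.
  elim/corner_ind: u => [|u i [q [qa qb]]].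
    exists p; split; first by rewrite a0; apply: walkClass_refl hp.
    by move: bp; rewrite -bc [clsOf _](clsOf_vtx (n := n)).
  exists (rcons q (edgeat s u i)).
  have := proj2 ok (fm_edgeat u i) q; have := ok2 (fm_edgeat u i) q.
  by rewrite /= fm_edgeat0 fm_edgeat1 => h1 h2; split; [apply: h2|apply: h1].
have [hu _] := ha u; have hq := walkClass_end hu qa.
rewrite (walkClassP hq qa); have /= [r [hr br]] := ok1 u.
by rewrite br; rewrite br in qb; rewrite (walkClassP hq qb).
Qed.

Lemma walkBase_subproof : walkCellOk (x : X 0, fun _ : corner 0 => walkClass [::]).
Proof.
split=> [u|g p] /=; first by exists [::]; rewrite vtx_vertex.
by have [[]] := fm_edgeatP g.
Qed.
Definition walkBase : walkCells 0 := exist (walkCellOk (n := 0)) _ walkBase_subproof.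

Lemma clsOf_base : clsOf walkBase [::].
Proof. exact: (@walkClass_refl [::] x). Qed.

Lemma walkCells_reach c : reach walkBase c.
Proof.
have [p [hp cp]] := clsOfP c.
have [P [c' [hP Pp ec']]] := walk_lift (u := walkBase) walkProj_covering hp.
suff <- : c' = c by exists P.
apply: (@walkVertex_eq _ _ p) => //; last by rewrite cp; apply: walkClass_refl hp.
by have := clsOf_walk hP clsOf_base; rewrite Pp.
Qed.

Lemma walkCells_connected : subcomplex_connected (fun n => [set: walkCells n]).
Proof.
split=> [|u v _ _]; first by exists walkBase.
have [p hp] := reach_trans (reach_sym (walkCells_reach u)) (walkCells_reach v).
by exists p.
Qed.

Lemma walkCells_end P P' c c' : walk walkBase P c -> walk walkBase P' c' ->
  (c = c' <-> R (map (walkProj 1) P) (map (walkProj 1) P')).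
Proof.
move=> hP hP'.
have cP := clsOf_walk hP clsOf_base; have cP' := clsOf_walk hP' clsOf_base.
have hp := map_walk walkProj hP; have hp' := map_walk walkProj hP'.
rewrite /= in cP cP' hp hp'.
split=> [ecc'|RPP'].
  rewrite ecc' in cP; have [q [_ cq]] := clsOfP c'; rewrite cq in cP cP'.
  exact: R_trans (R_sym (proj2 cP)) (proj2 cP').
apply: (@walkVertex_eq _ _ (map (walkProj 1) P)) => //; first exact: R_end RPP'.
have [q [_ cq]] := clsOfP c'; rewrite cq in cP' *; split; first by exists (walkProj 0 c).
exact: R_trans (proj2 cP') (R_sym RPP').
Qed.

Lemma walkProj_finite (T : finType) (h : seq (X 1) -> T) :
  (forall p p' v, walk x p v -> walk x p' v -> h p = h p' -> R p p') ->
  finite_sheeted walkProj.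
Proof.
move=> hR v; pose rep c := proj1_sig (cid (clsOfP c)).
apply: (@finite_inj _ T _ (h \o rep)) => c c' /= cv c'v.
rewrite /rep; case: cid => p [hp cp]; case: cid => p' [hp' c'p'] /= pp'.
apply: (@walkVertex_eq _ _ p'); first exact: etrans cv (esym c'v).
  rewrite cp; split; first by exists (walkProj 0 c').
  by apply: (hR p p' v) pp'; [rewrite -cv|rewrite -c'v].
by rewrite c'p'; apply: walkClass_refl hp'.
Qed.

End WalkCover.

(** The finite cover that belongs to a subgroup of finite index of the fundamental
    group: [R] is the relation of being in the same coset, and the index is finite
    because there are finitely many values of [h]. *)
Theorem walk_cover (X : cubeComplex) (x : X 0)
    (R : seq (X 1) -> seq (X 1) -> Prop) (T : finType) (h : seq (X 1) -> T) :
  (forall p p', R p p' -> R p' p) ->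
  (forall p p' p'', R p p' -> R p' p'' -> R p p'') ->
  (forall p p' v v', walk x p v -> walk x p' v' -> R p p' -> v = v') ->
  (forall p p' v, walk x p v -> homotopy p p' -> R p p') ->
  (forall p p' e, walk x p (src e) -> walk x p' (src e) ->
     R p p' -> R (rcons p e) (rcons p' e)) ->
  (forall p p' v, walk x p v -> walk x p' v -> h p = h p' -> R p p') ->
  exists (C : cubeComplex) (c0 : C 0) (kappa : cubeMap C X),
    [/\ covering kappa, finite_sheeted kappa, kappa 0 c0 = x &
      forall P P' c c', walk c0 P c -> walk c0 P' c' ->
        (c = c' <-> R (map (kappa 1) P) (map (kappa 1) P'))].
Proof.
move=> R_sym R_trans R_end R_hom R_rcons R_fin.
exists (CubeComplex (walkCells_connected R_sym R_trans R_end R_hom R_rcons)).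
exists (walkBase x R).
exists (walkProj x R); split=> //.
- exact: walkProj_covering.
- exact: walkProj_finite R_fin.
- exact: walkCells_end.
Qed.

Definition walkEnd (X : cubeCells) (u : X 0) p : X 0 := last u (map (@tgt X) p).

Lemma walk_walkEnd (X : cubeCells) (u v : X 0) p : walk u p v -> walkEnd u p = v.
Proof. by elim: p u => [//|e p IH u /= [_ /IH]]. Qed.

Lemma walkEnd_rcons (X : cubeCells) (u : X 0) p e : walkEnd u (rcons p e) = tgt e.
Proof. by rewrite /walkEnd map_rcons last_rcons. Qed.

Lemma walkEnd_cat (X : cubeCells) (u : X 0) p q :
  walkEnd u (p ++ q) = walkEnd (walkEnd u p) q.
Proof. by rewrite /walkEnd map_cat last_cat. Qed.

Lemma walkEnd_map (X Y : cubeCells) (f : cubeMap X Y) (u : X 0) p :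
  walkEnd (f 0 u) (map (f 1) p) = f 0 (walkEnd u p).
Proof.
by elim: p u => [//|e p IH] u; rewrite /walkEnd /= map_tgt; apply: IH.
Qed.

Lemma finite_dfun_code (I : finType) (V : I -> Type) :
  (forall i, finite_set [set: V i]) ->
  exists (T : finType) (h : (forall i, V i) -> T), injective h.
Proof.
move=> V_fin; pose T i := proj1_sig (cid (finite_code (V_fin i))).
have [f f_inj] : exists f : forall i, V i -> T i, forall i, injective (f i).
  pose F i := cid (proj2_sig (cid (finite_code (V_fin i)))).
  by exists (fun i => proj1_sig (F i)) => i; apply: (proj2_sig (F i)).
exists {dffun forall i, T i}, (fun s => finfun (fun i => f i (s i))) => s t st.
apply: functional_extensionality_dep => i; apply: f_inj.
by move/ffunP/(_ i): st; rewrite !ffunE.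
Qed.

(** * Positions of imitators in a cover *)

(** The positions of the imitators are well defined on the cover in which walks
    are told apart by the ends of the walker and of all the imitators. *)
Lemma imitator_cover (n : nat) (X : cubeComplex) (x : X 0) (Z : 'I_n -> cubeCells)
    (z : forall i, Z i 0) (psi : forall i, cubeMap (Z i) X) :
  special X -> (forall i, local_isometry (psi i)) ->
  (forall i, finite_set [set: Z i 0]) ->
  exists (C : cubeComplex) (c0 : C 0) (kappa : cubeMap C X)
      (pos : forall i, C 0 -> Z i 0),
    [/\ covering kappa, finite_sheeted kappa, kappa 0 c0 = x,
        forall i, pos i c0 = z i
      & forall i e, pos i (tgt e) = imitStep (psi i) (pos i (src e)) (kappa 1 e)].
Proof.
move=> X_special psi_isom Z_fin.
have [T [h h_inj]] := finite_dfun_code Z_fin.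
pose st p i := imitEnd (psi i) (z i) p.
pose R p p' := walkEnd x p = walkEnd x p' /\ st p = st p'.
have [||||||C [c0 [kappa [k_cov k_fin kc0 k_end]]]] :=
  @walk_cover X x R T (h \o st).
- by move=> p p' [h1 h2].
- by move=> p p' p'' [h1 h2] [h3 h4]; rewrite /R h1 h2.
- by move=> p p' v v' /walk_walkEnd <- /walk_walkEnd <- [].
- move=> p p' v hp pp'; split.
    by rewrite (walk_walkEnd hp) (walk_walkEnd (homotopy_walk pp' hp)).
  by apply: functional_extensionality_dep => i; apply: imitEnd_homotopy.
- move=> p p' e _ _ [_ pp']; split; first by rewrite !walkEnd_rcons.
  apply: functional_extensionality_dep => i.
  have := congr1 (fun s : forall j, Z j 0 => s i) pp'.
  by rewrite /st /imitEnd !foldl_rcons => ->.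
- move=> p p' v /walk_walkEnd pv /walk_walkEnd p'v /h_inj pp'.
  by split=> //; rewrite pv.
have c0_reach c : exists P, walk c0 P c.
  have [_ /(_ c0 c)[//|//|P [hP _]]] := cells_connected C.
  by exists P.
pose pos i c := st (map (kappa 1) (proj1_sig (cid (c0_reach c)))) i.
have posE i c P : walk c0 P c -> pos i c = st (map (kappa 1) P) i.
  rewrite /pos; case: cid => P' hP' /= hP.
  by have [/(_ erefl)[_ ->]] := k_end _ _ _ _ hP' hP.
exists C, c0, kappa, pos; split=> // [i|i e].
  exact: (posE i c0 [::]).
have [P hP] := c0_reach (src e).
rewrite (posE i _ _ hP) (posE i _ _ (walk_rcons hP)) map_rcons.
by rewrite /st /imitEnd foldl_rcons.
Qed.

Section Tracking.
Variables (X C Z : cubeCells) (kappa : cubeMap C X) (psi : cubeMap Z X).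
Variable pos : C 0 -> Z 0.
Hypothesis X_special : special X.
Hypothesis psi_isom : local_isometry psi.
Hypothesis pos_step : forall e, pos (tgt e) = imitStep psi (pos (src e)) (kappa 1 e).

(** The imitator stands at the same place of the cube [t] as the walker of the cube
    [c] over it. *)
Definition tracks m (c : C m) (t : Z m) : Prop :=
  base t = pos (base c) /\ psi m t = kappa m c.

Lemma tracks_vtx m (c : C m) t u : tracks c t -> pos (vtx c u) = vtx t u.
Proof.
case=> bt pt; elim/corner_ind: u => [//|u i IH].
rewrite -tgt_edgeat pos_step src_edgeat IH.
rewrite /imitStep (@imitEdge_some _ _ _ X_special psi_isom _ _ (edgeat t u i)).
  by rewrite tgt_edgeat.
by apply: follows_edge; [apply: src_edgeat|rewrite -!map_edgeat pt].
Qed.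

(** An imitator that is with the walker at one corner of a cube is with it at all
    corners, since it is taken along on each edge. *)
Lemma tracks_face l m (f : faceMap l m) (c : C m) t :
  tracks c t -> tracks (face f c) (face f t).
Proof.
move=> ct; split; last by rewrite !cmap_face (proj2 ct).
by rewrite !base_face; apply/esym/tracks_vtx.
Qed.

Lemma tracks_uniq m (c : C m) t t' : tracks c t -> tracks c t' -> t = t'.
Proof.
case=> bt pt [bt' pt']; have [inj _] := psi_isom (base t).
by apply: inj => //; rewrite ?bt ?bt' // pt pt'.
Qed.

Lemma tracks_convex m (c : C m) : (exists z, tracks (base c) z) ->
  (forall i, exists f, tracks (axis i c) f) -> exists t, tracks c t.
Proof.
move=> [z [bz pz]] ht; rewrite !base_vertex in bz; subst z.
have bc : base (kappa m c) = psi 0 (pos (base c)) by rewrite map_base.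
have [|t [bt pt]] := (proj2 (psi_isom _)) _ _ bc; last by exists t.
move=> i; have [f [bf pf]] := ht i; exists f.
split; last by rewrite map_axis.
by apply: etrans bf _; congr pos; apply: src_axis.
Qed.

Definition moved (e : C 1) : Prop := exists f, follows psi (pos (src e)) (kappa 1 e) f.

Lemma moved_rev e : moved e -> moved (reverse e).
Proof.
case=> f hf; exists (reverse f).
rewrite src_reverse pos_step /imitStep (imitEdge_some X_special psi_isom hf).
by rewrite -map_reverse; apply: follows_rev hf.
Qed.

Lemma moved_par e e' : parallel e e' -> (moved e <-> moved e').
Proof.
elim/par_ind=> [//|e0 f0 h|e0 f0 g0 -> -> //|e0|q]; first by split=> /h.
  by split=> [|/moved_rev]; [apply: moved_rev|rewrite reverseK].
rewrite /moved src_sqa' pos_step src_sqa src_sqb -!map_sq.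
by split=> -[f]; [apply: follows_sqa|apply: follows_sqa_inv].
Qed.

(** By [moved_par] the imitator moves when the walker crosses [e], because it did so
    at [e']; as they stand at the same place, they cross the same edge. *)
Lemma tracks_par e e' : parallel e e' -> (exists t, tracks e' t) ->
  (exists z, tracks (src e) z) -> exists t, tracks e t.
Proof.
move=> ee' [t' [bt' pt']] [z [bz pz]].
have [f [fz ef]] : moved e.
  by apply/(moved_par ee'); exists t'; apply: follows_edge.
exists f; split=> //.
move: bz pz; rewrite !base_vertex => bz pz.
apply: (proj1 X_special); last exact: par_sym.
by rewrite !map_src fz -bz pz.
Qed.

End Tracking.

Lemma finite_sub (V : Type) (P : V -> Prop) :
  finite_set [set: V] -> finite_set [set: {v | P v}].
Proof.
move=> V_fin; apply: (@sub_finite_set _ _ (@proj1_sig _ _ @^-1` [set: V])) => //.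
by apply: finite_preimage => // u v _ _; apply: sig_inj.
Qed.

Lemma finite_fun (J V : Type) : finite_set [set: J] -> finite_set [set: V] ->
  finite_set [set: J -> V].
Proof.
move=> /finite_code[TJ [cJ cJ_inj]] /finite_code[TV [cV cV_inj]].
pose h (s : J -> V) : {ffun TJ -> option TV} := [ffun t =>
  if pselect (exists j, cJ j = t) is left h then Some (cV (s (proj1_sig (cid h))))
  else None].
apply: (@finite_inj _ _ _ h) => s t _ _ /ffunP st; apply/funext => j.
have := st (cJ j); rewrite !ffunE; case: pselect => [ex|]; last by case; exists j.
by case: cid => k /= /cJ_inj -> [/cV_inj].
Qed.

(** * Regular covers *)

Definition deck (X Y : cubeCells) (f : cubeMap Y X) (g g' : cubeMap Y Y) : Prop :=
  [/\ forall n, cancel (g n) (g' n), forall n, cancel (g' n) (g n),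
      forall n s, f n (g n s) = f n s & forall n s, f n (g' n s) = f n s].

Lemma deck_sym (X Y : cubeCells) (f : cubeMap Y X) g g' :
  deck f g g' -> deck f g' g.
Proof. by case. Qed.

Lemma deck_id (X Y : cubeCells) (f : cubeMap Y X) : deck f (cmap_id Y) (cmap_id Y).
Proof. by []. Qed.

Lemma deck_comp (X Y : cubeCells) (f : cubeMap Y X) g g' h h' :
  deck f g g' -> deck f h h' -> deck f (cmap_comp g h) (cmap_comp h' g').
Proof.
case=> gK g'K fg fg' [hK h'K fh fh']; split=> n s /=.
- by rewrite gK hK.
- by rewrite h'K g'K.
- by rewrite fg fh.
- by rewrite fh' fg'.
Qed.

Section Regular.
Variables (X Y : cubeCells) (f : cubeMap Y X) (x : X 0).
Hypothesis f_cov : covering f.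

Definition fibre := {y : Y 0 | f 0 y = x}.

(** A cube of the regular cover over a cube of [X] is a bijection from the fibre
    of [x] to the set of its lifts; the permutations of the fibre then act by
    deck transformations, simply transitively over each cube. *)
Definition fibreOk n (s : fibre -> Y n) : Prop :=
  (forall j k, f n (s j) = f n (s k)) /\
  (forall j t, f n t = f n (s j) -> exists! k, s k = t).

Definition fibreCell n := {s | fibreOk (n := n) s}.

Lemma fibre_face_subproof m n (g : faceMap m n) (s : fibreCell n) :
  fibreOk (fun j => face g (proj1_sig s j)).
Proof.
case: s => s [s_fib s_bij] /=; split=> [j k|j t].
  by rewrite !cmap_face (s_fib j k).
rewrite cmap_face => /(cov_face_lift f_cov)[t' [gt' ft']].
have [k [sk k_uniq]] := s_bij j t' ft'.
exists k; split=> [|k' gk']; first by rewrite sk.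
apply: k_uniq; apply: (cov_face_uniq f_cov (g := g)); first by rewrite gk' gt'.
by rewrite ft'; apply: s_fib.
Qed.

Definition fibre_face m n (g : faceMap m n) (s : fibreCell n) : fibreCell m :=
  exist (fibreOk (n := m)) _ (fibre_face_subproof g s).

Lemma fibre_face_id n (s : fibreCell n) : fibre_face (fm_id n) s = s.
Proof. by apply: sig_inj; apply/funext => j; apply: face_id. Qed.

Lemma fibre_face_comp l m n (g : faceMap m n) (h : faceMap l m) (s : fibreCell n) :
  fibre_face (fm_comp g h) s = fibre_face h (fibre_face g s).
Proof. by apply: sig_inj; apply/funext => j; apply: face_comp. Qed.

Variable j0 : fibre.

Lemma fibre_face_free n (g : faceMap n n) (s : fibreCell n) :
  fibre_face g s = s -> g = fm_id n.
Proof. by move/(congr1 (fun s => proj1_sig s j0)); apply: face_free. Qed.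

Definition fibreCells := CubeCells fibre_face_id fibre_face_comp fibre_face_free.

Definition fibreEval : cubeMap fibreCells Y :=
  @CubeMap fibreCells Y (fun n s => proj1_sig s j0) (fun m n g s => erefl).

Lemma fibreEval_covering : covering fibreEval.
Proof.
move=> c n s sc; have [c_fib c_bij] := proj2_sig c.
have hlift j : exists t, base t = proj1_sig c j /\ f n t = f n s.
  by apply: (cov_lift f_cov); rewrite map_base sc; apply: c_fib.
pose t j := proj1_sig (cid (hlift j)).
have tP j : base (t j) = proj1_sig c j /\ f n (t j) = f n s.
  exact: (proj2_sig (cid (hlift j))).
have ok : fibreOk t.
  split=> [j k|j t' ft']; first by rewrite !(proj2 (tP _)).
  have [|k [ck k_uniq]] := c_bij j (base t').
    by rewrite -map_base ft' map_base (proj1 (tP j)).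
  exists k; split=> [|k' tk'].
    apply: (cov_uniq f_cov); first by rewrite (proj1 (tP k)).
    by rewrite ft' !(proj2 (tP _)).
  by apply: k_uniq; rewrite -tk' (proj1 (tP k')).
exists (exist (fibreOk (n := n)) _ ok); split.
  split; first by apply: sig_inj; apply/funext => j; apply: (proj1 (tP j)).
  apply: (cov_uniq f_cov); last exact: (proj2 (tP j0)).
  by rewrite sc; apply: (proj1 (tP j0)).
case=> r [r_fib r_bij] [/= br rs]; apply: sig_inj; apply/funext => /= j.
apply: (cov_uniq f_cov); last by rewrite (proj2 (tP j)) -rs; apply: r_fib.
by rewrite (proj1 (tP j)) -br.
Qed.

Definition fibreProj : cubeMap fibreCells X := cmap_comp f fibreEval.

Lemma permute_subproof (a b : fibre -> fibre) : cancel a b -> cancel b a ->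
  forall n (s : fibreCell n), fibreOk (proj1_sig s \o a).
Proof.
move=> aK bK n [s [s_fib s_bij]] /=; split=> [j k|j t] /=; first exact: s_fib.
move=> /s_bij[k [sk k_uniq]]; exists (b k); split=> [|k' /= /k_uniq ->] //=.
by rewrite bK.
Qed.

Definition permute_cube a b (aK : cancel a b) (bK : cancel b a) n
    (s : fibreCells n) : fibreCells n :=
  exist (fibreOk (n := n)) _ (permute_subproof aK bK s).

Lemma permute_face a b (aK : cancel a b) (bK : cancel b a) m n (g : faceMap m n)
    (s : fibreCells n) :
  permute_cube aK bK (face g s) = face g (permute_cube aK bK s).
Proof. exact: sig_inj. Qed.

Definition permute a b (aK : cancel a b) (bK : cancel b a) :
    cubeMap fibreCells fibreCells := CubeMap (permute_face aK bK).

Lemma permute_deck a b (aK : cancel a b) (bK : cancel b a) :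
  deck fibreProj (permute aK bK) (permute bK aK).
Proof.
split=> n s.
- by apply: sig_inj; apply/funext => j /=; rewrite bK.
- by apply: sig_inj; apply/funext => j /=; rewrite aK.
- by have [s_fib _] := proj2_sig s; apply: s_fib.
- by have [s_fib _] := proj2_sig s; apply: s_fib.
Qed.

(** Two bijections from the fibre to the lifts of the same vertex differ by a
    permutation of the fibre. *)
Lemma fibre_transitive (u v : fibreCells 0) : fibreProj 0 u = fibreProj 0 v ->
  exists g g', deck fibreProj g g' /\ g 0 u = v.
Proof.
have [u_fib u_bij] := proj2_sig u; have [v_fib v_bij] := proj2_sig v => uv.
have uv_fib j k : f 0 (proj1_sig v j) = f 0 (proj1_sig u k).
  by rewrite (v_fib j j0) (u_fib k j0).
have ha j := u_bij j0 _ (uv_fib j j0); have hb j := v_bij j0 _ (esym (uv_fib j0 j)).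
pose a j := proj1_sig (cid (ha j)); pose b j := proj1_sig (cid (hb j)).
have aP j : proj1_sig u (a j) = proj1_sig v j := proj1 (proj2_sig (cid (ha j))).
have bP j : proj1_sig v (b j) = proj1_sig u j := proj1 (proj2_sig (cid (hb j))).
have u_inj j k : proj1_sig u j = proj1_sig u k -> j = k.
  by move=> jk; have [l [_ h]] := u_bij j _ erefl; rewrite -(h j) // -(h k).
have v_inj j k : proj1_sig v j = proj1_sig v k -> j = k.
  by move=> jk; have [l [_ h]] := v_bij j _ erefl; rewrite -(h j) // -(h k).
have aK : cancel a b by move=> j; apply: v_inj; rewrite bP aP.
have bK : cancel b a by move=> j; apply: u_inj; rewrite aP bP.
exists (permute aK bK), (permute bK aK); split; first exact: permute_deck.
by apply: sig_inj; apply/funext => j /=; apply: aP.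
Qed.

End Regular.

(** Here [W] need not be connected, which makes all the permutations of the fibre
    available as deck transformations. *)
Lemma regular_cover (X Y : cubeCells) (f : cubeMap Y X) (x : X 0) :
  covering f -> (exists y, f 0 y = x) -> special Y -> finite_set [set: Y 0] ->
  exists (W : cubeCells) (p : cubeMap W X) (w : W 0),
    [/\ covering p, p 0 w = x, special W, finite_set [set: W 0]
      & forall u v, p 0 u = p 0 v -> exists g g', deck p g g' /\ g 0 u = v].
Proof.
move=> f_cov [y yx] Y_special Y_fin; pose j0 : fibre f x := exist _ y yx.
have w_ok : fibreOk (fun j : fibre f x => proj1_sig j).
  split=> [[u hu] [v hv] /=|[u hu] t /= ft]; first by rewrite hu hv.
  rewrite hu in ft; exists (exist _ t ft); split=> // k ek; exact: sig_inj.
exists (fibreCells f_cov j0), (fibreProj f_cov j0), (exist (fibreOk (n := 0)) _ w_ok).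
split=> //.
- exact: (covering_comp f_cov (@fibreEval_covering _ _ f x f_cov j0)).
- exact: special_cover (@fibreEval_covering _ _ f x f_cov j0) Y_special.
- by apply: finite_sub; apply: finite_fun => //; apply: finite_sub.
- exact: fibre_transitive.
Qed.

(** * Subcomplexes *)

Section Subcells.
Variables (X : cubeCells) (A : forall m, set (X m)).
Hypothesis A_face : forall l m (f : faceMap l m) (s : X m), A s -> A (face f s).

Definition subcell n := {s : X n | A s}.

Definition subcell_face m n (f : faceMap m n) (s : subcell n) : subcell m :=
  exist (fun t : X m => A t) _ (A_face f (proj2_sig s)).

Lemma subcell_face_id n (s : subcell n) : subcell_face (fm_id n) s = s.
Proof. by apply: sig_inj; apply: face_id. Qed.

Lemma subcell_face_comp l m n (g : faceMap m n) (f : faceMap l m) (s : subcell n) :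
  subcell_face (fm_comp g f) s = subcell_face f (subcell_face g s).
Proof. by apply: sig_inj; apply: face_comp. Qed.

Lemma subcell_face_free n (f : faceMap n n) (s : subcell n) :
  subcell_face f s = s -> f = fm_id n.
Proof. by move/(congr1 (@proj1_sig _ _)); apply: face_free. Qed.

Definition subcells :=
  CubeCells subcell_face_id subcell_face_comp subcell_face_free.

Definition incl : cubeMap subcells X :=
  @CubeMap subcells X (fun n s => proj1_sig s) (fun m n f s => erefl).

Lemma incl_inj n : injective (incl n). Proof. exact: sig_inj. Qed.

Definition convex : Prop := forall m (s : X m),
  A (base s) -> (forall i, A (axis i s)) -> A s.

Lemma incl_isom : convex -> local_isometry incl.
Proof.
move=> A_convex y; split=> [n s t _ _ st|n s sy h]; first exact: incl_inj.
have As : A s.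
  apply: A_convex; first by rewrite sy; exact: (proj2_sig y).
  by move=> i; have [e [_ <-]] := h i; apply: (proj2_sig e).
by exists (exist (fun t : X n => A t) s As); split=> //; apply: sig_inj.
Qed.

Lemma incl_walk (z : subcells 0) P v : walk (incl 0 z) P v ->
  (forall e, List.In e P -> A e) ->
  exists Q z', [/\ walk z Q z', map (incl 1) Q = P & incl 0 z' = v].
Proof.
elim: P z => [z /= <- _|e P IH z /= [se hP] AP]; first by exists [::], z.
pose f : subcells 1 := exist (fun t : X 1 => A t) e (AP e (or_introl erefl)).
have [Q [z' [hQ QP z'v]]] : exists Q z',
    [/\ walk (tgt f) Q z', map (incl 1) Q = P & incl 0 z' = v].
  by apply: IH => // e' he'; exact: (AP _ (or_intror he')).
exists (f :: Q), z'; split=> //=; last by rewrite QP.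
by split=> //; apply: incl_inj.
Qed.

End Subcells.

(** * Composing imitators *)

Section Retractions.
Variables (n : nat) (W : cubeCells) (w0 : W 0) (A : 'I_n -> forall m, set (W m)).
Hypothesis W_special : special W.
Hypothesis A_face : forall i l m (f : faceMap l m) (s : W m), A i s -> A i (face f s).
Hypothesis A_convex : forall i, convex (A i).
Hypothesis A_par : forall i (e e' : W 1),
  parallel e e' -> A i e' -> A i (src e) -> A i e.
Hypothesis A_w0 : forall i, A i w0.

Let Z i := subcells (@A_face i).
Let inclA i : cubeMap (Z i) W := incl (@A_face i).
Let z0 i : Z i 0 := exist (fun t : W 0 => A i t) w0 (A_w0 i).
Let isomA i : local_isometry (inclA i) := incl_isom (@A_convex i).

Definition along i (P : seq (W 1)) : Prop := forall e, List.In e P -> A i e.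

Definition retract i (P : seq (W 1)) : seq (W 1) :=
  map (inclA i 1) (imit (inclA i) (z0 i) P).

Lemma retract_walk i P : exists v, walk w0 (retract i P) v.
Proof. by eexists; apply: map_walk (imit_walk _ _ _). Qed.

Lemma retract_along i P : along i (retract i P).
Proof. by move=> e /List.in_map_iff[f [<- _]]; apply: (proj2_sig f). Qed.

(** An imitator in [A i] crosses only edges parallel to edges of the walk; if the
    walk lies in [A j], then [A j] cannot be left across such an edge. *)
Lemma retract_stay i j P : along j P -> along j (retract i P).
Proof.
rewrite /retract; have : A j (inclA i 0 (z0 i)) by apply: A_w0.
elim: P (z0 i) => [//|e P IH] z /= jz jP.
have jP' : along j P by move=> e' he'; apply: jP; right.
case: imitEdgeP => [f [fz ef]|_]; last exact: IH.
have jf : A j (inclA i 1 f).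
  apply: A_par (par_sym ef) _ _; first by apply: jP; left.
  by rewrite map_src fz.
move=> e' /= [<- //|]; apply: IH jP' e'; rewrite -map_tgt; exact: A_face.
Qed.

Lemma retract_id i P v : walk w0 P v -> along i P -> retract i P = P.
Proof.
move=> hP iP; have [Q [z' [hQ QP _]]] := @incl_walk _ _ (@A_face i) (z0 i) P v hP iP.
by rewrite /retract -{1}QP (imit_exact W_special (@isomA i) hQ).
Qed.

Lemma retract_homotopy i P P' : homotopy P P' -> homotopy (retract i P) (retract i P').
Proof. by move=> h; apply/homotopy_map/imit_homotopy. Qed.

Definition retracts (w : seq 'I_n) (P : seq (W 1)) : seq (W 1) := foldr retract P w.

Lemma retracts_walk w P v : walk w0 P v -> exists v', walk w0 (retracts w P) v'.
Proof. by case: w => [|i w] hP; [exists v|apply: retract_walk]. Qed.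

Lemma retracts_cat w w' P : retracts (w ++ w') P = retracts w (retracts w' P).
Proof. exact: foldr_cat. Qed.

Lemma retracts_homotopy w P P' :
  homotopy P P' -> homotopy (retracts w P) (retracts w P').
Proof. by move=> h; elim: w => //= i w IH; apply: retract_homotopy. Qed.

(** The imitator in [A j] produces a walk in [A j], and by [retract_stay] the later
    ones keep it there. *)
Lemma retracts_along w j P : j \in w -> along j (retracts w P).
Proof.
elim: w => //= i w IH; rewrite inE => /orP[/eqP ->|/IH].
  exact: retract_along.
exact: retract_stay.
Qed.

Lemma retracts_id w P v : walk w0 P v -> (forall i, i \in w -> along i P) ->
  retracts w P = P.
Proof.
move=> hP; elim: w => //= i w IH h; rewrite IH => [|j jw].
  by apply: retract_id hP _; apply: h; rewrite mem_head.
by apply: h; rewrite inE jw orbT.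
Qed.

(** Since [undup] keeps the last occurrence of each letter, the letters that it
    drops are applied to walks which they fix. *)
Lemma retracts_undup w P v : walk w0 P v -> retracts (undup w) P = retracts w P.
Proof.
move=> hP; elim: w => //= i w IH; case: ifP => iw /=; rewrite IH //.
have [v' hw] := retracts_walk w hP.
by rewrite (retract_id hw) //; apply: retracts_along.
Qed.

Section Deck.
Variables (X : cubeCells) (f : cubeMap W X) (g g' : cubeMap W W).
Variable B : 'I_n -> forall m, set (X m).
Hypothesis AB : forall i m (s : W m), A i s <-> B i (f m s).
Hypothesis gg' : deck f g g'.

(** Imitation is defined by parallelism and by [A i], both of which are preserved by
    deck transformations because [A i] is a preimage. *)
Lemma imit_deck i (z z' : Z i 0) P : inclA i 0 z' = g 0 (inclA i 0 z) ->
  map (inclA i 1) (imit (inclA i) z' (map (g 1) P)) =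
  map (g 1) (map (inclA i 1) (imit (inclA i) z P)).
Proof.
have [gK g'K fg fg'] := gg'.
elim: P z z' => [//|e P IH] z z' zz' /=.
case: (imitEdgeP (inclA i) z e) => [h [hz eh]|nh].
  have Ah : A i (g 1 (inclA i 1 h)) by apply/AB; rewrite fg; apply/AB/(proj2_sig h).
  pose h' : Z i 1 := exist (fun t : W 1 => A i t) _ Ah.
  rewrite (@imitEdge_some _ _ _ W_special (@isomA i) _ _ h') /=.
    by congr cons; apply: IH; rewrite -map_tgt /= map_tgt.
  split; last exact: map_par.
  apply: incl_inj; change (src (g 1 (inclA i 1 h)) = inclA i 0 z').
  by rewrite map_src (map_src (inclA i)) hz zz'.
rewrite imitEdge_none; first exact: IH.
move=> h' [hz eh].
have Ah : A i (g' 1 (inclA i 1 h')).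
  by apply/AB; rewrite fg'; apply/AB/(proj2_sig h').
apply: (nh (exist (fun t : W 1 => A i t) _ Ah)); split.
  apply: incl_inj; change (src (g' 1 (inclA i 1 h')) = inclA i 0 z).
  by rewrite map_src (map_src (inclA i)) hz zz' gK.
by have := map_par g' eh; rewrite gK.
Qed.

(** The continuation [Q'] depends only on the position reached after [P], up to
    the deck transformation [g]. *)
Lemma retract_cat i P Q : exists Q', retract i (P ++ Q) = retract i P ++ Q' /\
  forall P', g 0 (walkEnd w0 (retract i P)) = walkEnd w0 (retract i P') ->
    retract i (P' ++ map (g 1) Q) = retract i P' ++ map (g 1) Q'.
Proof.
exists (map (inclA i 1) (imit (inclA i) (imitEnd (inclA i) (z0 i) P) Q)).
split=> [|P' PP']; first by rewrite /retract imit_cat map_cat.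
have zE R : walkEnd w0 (retract i R) = inclA i 0 (imitEnd (inclA i) (z0 i) R).
  exact: walk_walkEnd (map_walk (inclA i) (imit_walk (inclA i) (z0 i) R)).
rewrite /retract imit_cat map_cat; congr cat; apply: imit_deck.
by rewrite -!zE PP'.
Qed.

Lemma retracts_deck_cat P P' Q :
  (forall w, g 0 (walkEnd w0 (retracts w P)) = walkEnd w0 (retracts w P')) ->
  forall w, g 0 (walkEnd w0 (retracts w (P ++ Q))) =
    walkEnd w0 (retracts w (P' ++ map (g 1) Q)).
Proof.
move=> PP' w; suff [Q' [-> ->]] : exists Q', retracts w (P ++ Q) = retracts w P ++ Q' /\
    retracts w (P' ++ map (g 1) Q) = retracts w P' ++ map (g 1) Q'.
  by rewrite !walkEnd_cat -PP' walkEnd_map.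
elim: w => [|i w [Q1 [e1 e2]]] /=; first by exists Q.
have [Q' [h1 h2]] := retract_cat i (retracts w P) Q1.
exists Q'; rewrite e1 e2; split=> //; apply: h2.
exact: (PP' (i :: w)).
Qed.

End Deck.

End Retractions.

(** A backtrack or a square lifts by uniqueness of lifts of edges. *)
Lemma homotopy_lift (X Y : cubeCells) (f : cubeMap Y X) u P v p' : covering f ->
  walk u P v -> homotopy (map (f 1) P) p' ->
  exists P', homotopy P P' /\ map (f 1) P' = p'.
Proof.
move=> f_cov hP h; move ep : (map (f 1) P) h => p h.
have two a c d b : p = a ++ [:: c, d & b] -> exists A C D B,
    [/\ P = A ++ [:: C, D & B], map (f 1) A = a, f 1 C = c, f 1 D = d
      & map (f 1) B = b] /\ src D = tgt C.
  rewrite -ep => {h ep}; elim: a P u hP => [|a0 a IH] [|C P] //= u [uC hP].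
    case: P hP => [//|D B] /= [CD _] [<- <- <-].
    by exists [::], C, D, B.
  case=> fC /(IH _ _ hP)[A [C' [D [B [[-> <- <- <- <-] CD]]]]].
  by exists (C :: A), C', D, B; rewrite -fC.
case: h ep two => [r|a e b|a q b] ep two.
- by exists P; split=> //; apply: Homotopy_refl.
- have [A [C [D [B [[-> <- fC fD <-] CD]]]]] := two _ _ _ _ erefl.
  exists (A ++ B); rewrite map_cat; split=> //.
  suff -> : D = reverse C by apply: Homotopy_back.
  apply: (cov_uniq f_cov); last by rewrite fD -fC map_reverse.
  by apply: etrans CD _; rewrite -src_reverse.
- have [A [C [D [B [[-> <- fC fD <-] CD]]]]] := two _ _ _ _ erefl.
  have [|Q [bQ fQ]] := @cov_lift _ _ f f_cov _ q (src C).
    by rewrite -map_src fC src_sqa.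
  have eC : C = sqa Q.
    apply: (cov_uniq f_cov); last by rewrite -map_sq fQ.
    by apply: etrans (esym bQ) _; rewrite -src_sqa.
  have eD : D = sqb' Q.
    apply: (cov_uniq f_cov); last by rewrite -map_sq fQ.
    by apply: etrans CD _; rewrite eC -src_sqb'.
  exists (A ++ [:: sqb Q, sqa' Q & B]); split; last first.
    by rewrite map_cat /= -!map_sq fQ.
  by rewrite eC eD; apply: Homotopy_square.
Qed.

(** * Connected intersections *)

Section IntersectionCover.
Variables (n : nat) (X : cubeComplex) (W : cubeCells) (f : cubeMap W X) (w0 : W 0).
Variable B : 'I_n -> forall m, set (X m).
Hypothesis f_cov : covering f.
Hypothesis W_special : special W.
Hypothesis W_fin : finite_set [set: W 0].
Hypothesis f_regular : forall u v, f 0 u = f 0 v ->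
  exists g g', deck f g g' /\ g 0 u = v.
Hypothesis B_face : forall i l m (h : faceMap l m) (s : X m), B i s -> B i (face h s).
Hypothesis B_convex : forall i, convex (B i).
Hypothesis B_par : forall i (e e' : X 1),
  parallel e e' -> B i e' -> B i (src e) -> B i e.
Hypothesis B_x : forall i, B i (f 0 w0).

Let A i m : set (W m) := [set s | B i (f m s)].

Let A_face i l m (h : faceMap l m) (s : W m) : A i s -> A i (face h s).
Proof. by rewrite /A /= cmap_face; apply: B_face. Qed.

Let A_convex i : convex (A i).
Proof.
move=> m s; rewrite /A /= -map_base => Bs Bax; apply: B_convex => // j.
by rewrite map_axis; apply: Bax.
Qed.

Let A_par i (e e' : W 1) : parallel e e' -> A i e' -> A i (src e) -> A i e.
Proof.
rewrite /A /= -map_src => ee'; apply: B_par; exact: map_par.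
Qed.

Let ret := retracts A_face B_x.
Let ends w P := walkEnd w0 (ret w P).

Definition lifts (P : seq (W 1)) (p : seq (X 1)) : Prop :=
  (exists v, walk w0 P v) /\ map (f 1) P = p.

Lemma lifts_ex p v : walk (f 0 w0) p v -> exists P, lifts P p.
Proof. by case/(walk_lift f_cov)=> P [v' [hP Pp _]]; exists P; split=> //; exists v'. Qed.

Lemma lifts_uniq P P' p : lifts P p -> lifts P' p -> P = P'.
Proof.
move=> [[v hP] Pp] [[v' hP'] P'p]; apply: (walk_lift_uniq f_cov hP hP').
by rewrite Pp P'p.
Qed.

(** Walks of [X] with the same end may lift to walks of [W] with different ends;
    the deck transformation [g] is there to identify them nevertheless when the
    imitators treat them alike. *)
Definition sameEnds (p p' : seq (X 1)) : Prop := exists P P' g g',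
  [/\ lifts P p, lifts P' p', deck f g g' & forall w, g 0 (ends w P) = ends w P'].

Lemma sameEnds_sym p p' : sameEnds p p' -> sameEnds p' p.
Proof.
case=> P [P' [g [g' [Pp P'p' gg' PP']]]]; exists P', P, g', g; split=> //.
  exact: deck_sym.
by case: gg' => gK _ _ _ w; rewrite -PP' gK.
Qed.

Lemma sameEnds_trans p p' p'' : sameEnds p p' -> sameEnds p' p'' -> sameEnds p p''.
Proof.
case=> P [P' [g [g' [Pp P'p' gg' PP']]]] [Q [P'' [h [h' [Qp' P''p'' hh' QP'']]]]].
exists P, P'', (cmap_comp h g), (cmap_comp g' h'); split=> //.
  exact: deck_comp.
by move=> w /=; rewrite PP' (lifts_uniq P'p' Qp').
Qed.

Lemma ends_nil P v : walk w0 P v -> ends [::] P = v.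
Proof. exact: walk_walkEnd. Qed.

Lemma sameEnds_end p p' v v' : walk (f 0 w0) p v -> walk (f 0 w0) p' v' ->
  sameEnds p p' -> v = v'.
Proof.
move=> hp hp' [P [P' [g [g' [[[u hP] Pp] [[u' hP'] P'p'] [_ _ fg _] /(_ [::])]]]]].
rewrite (ends_nil hP) (ends_nil hP') => uu'.
have := map_walk f hP; rewrite Pp => /(walk_end hp) ->.
have := map_walk f hP'; rewrite P'p' => /(walk_end hp') ->.
by rewrite -uu' fg.
Qed.

Lemma ends_walk w P v : walk w0 P v -> walk w0 (ret w P) (ends w P).
Proof.
move=> hP; have [v' hv'] := retracts_walk A_face B_x w hP.
by rewrite /ends (walk_walkEnd hv').
Qed.

Lemma sameEnds_homotopy p p' v : walk (f 0 w0) p v -> homotopy p p' -> sameEnds p p'.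
Proof.
move=> hp pp'; have [P Pp] := lifts_ex hp; have [[u hP] eP] := Pp.
rewrite -eP in pp'; have [P' [PP' eP']] := homotopy_lift f_cov hP pp'.
have hP' := homotopy_walk PP' hP.
exists P, P', (cmap_id W), (cmap_id W); split=> //; first by split=> //; exists u.
move=> w /=; apply: walk_end (ends_walk w hP'); apply: homotopy_walk (ends_walk w hP).
exact: (@retracts_homotopy _ _ _ A W_special A_face A_convex B_x).
Qed.

Lemma sameEnds_rcons p p' e : walk (f 0 w0) p (src e) -> walk (f 0 w0) p' (src e) ->
  sameEnds p p' -> sameEnds (rcons p e) (rcons p' e).
Proof.
move=> hp hp' [P [P' [g [g' [[[u hP] Pp] [[u' hP'] P'p'] gg' PP']]]]].
have fu : src e = f 0 u by have := map_walk f hP; rewrite Pp => /(walk_end hp).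
have [E [uE fE]] := cov_lift f_cov fu.
have gu : g 0 u = u' by have := PP' [::]; rewrite (ends_nil hP) (ends_nil hP').
have [_ _ fg _] := gg'.
exists (rcons P E), (rcons P' (g 1 E)), g, g'; split=> //.
- split; last by rewrite map_rcons Pp fE.
  by exists (tgt E); apply: walk_rcons; rewrite [src E]uE.
- split; last by rewrite map_rcons P'p' fg fE.
  by exists (tgt (g 1 E)); apply: walk_rcons; rewrite map_src [src E]uE gu.
move=> w; rewrite -!cats1.
exact: (retracts_deck_cat (B := B) W_special A_convex
         (fun i m s => iff_refl (A i s)) gg').
Qed.

(** By [retracts_undup] the ends are determined by those for words without
    repetition, which have length at most [n]. *)
Lemma sameEnds_finite : exists (T : finType) (h : seq (X 1) -> T),
  forall p p' v, walk (f 0 w0) p v -> walk (f 0 w0) p' v -> h p = h p' -> sameEnds p p'.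
Proof.
have [T [c c_inj]] := finite_code W_fin.
have [lift liftP] : exists lift : seq (X 1) -> seq (W 1),
    forall p v, walk (f 0 w0) p v -> lifts (lift p) p.
  have : forall p, exists P, forall v, walk (f 0 w0) p v -> lifts P p.
    move=> p; have [[v hp]|np] := pselect (exists v, walk (f 0 w0) p v).
      by have [P Pp] := lifts_ex hp; exists P.
    by exists [::] => v hp; case: np; exists v.
  by move/choice=> [lift h]; exists lift => p v; apply: h.
exists {ffun {bseq n of 'I_n} -> T}, (fun p => [ffun w : {bseq n of 'I_n} => c (ends w (lift p))]).
move=> p p' v hp hp' /ffunP pp'.
have := liftP _ _ hp; have := liftP _ _ hp'.
exists (lift p), (lift p'), (cmap_id W), (cmap_id W); split=> // w /=.
have [[[u hP] _] [[u' hP'] _]] := (liftP _ _ hp, liftP _ _ hp').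
rewrite /ends /ret -(retracts_undup W_special A_face A_convex A_par B_x w hP).
rewrite -(retracts_undup W_special A_face A_convex A_par B_x w hP').
have hw : size (undup w) <= n.
  by rewrite -(card_uniqP (undup_uniq w)) -[leqRHS]card_ord max_card.
by apply: c_inj; have := pp' (Bseq hw); rewrite !ffunE.
Qed.

(** The walk [q] is the image of one of the [p i] under the composite of the
    imitators in [E].  In [shrink] its last letter [j] is removed by passing to
    the walk [p j], which the imitator in [A j] fixes, and back. *)
Lemma sameEnds_inter (E : set 'I_n) v : (exists i, E i) ->
  forall p : 'I_n -> seq (X 1),
  (forall i, E i -> walk (f 0 w0) (p i) v /\ along B i (p i)) ->
  (forall i j, E i -> E j -> sameEnds (p i) (p j)) ->
  exists q v', [/\ walk (f 0 w0) q v', forall i, E i -> along B i q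
    & forall i, E i -> sameEnds q (p i)].
Proof.
move=> [i0 Ei0] p hp pp.
have alongA i P : along B i (map (f 1) P) -> along A i P.
  by move=> h e he; apply: h; apply/List.in_map_iff; exists e.
have shrink (L : seq 'I_n) : (forall j, j \in L -> E j) -> forall P, lifts P (p i0) ->
    exists g g', deck f g g' /\ forall w, g 0 (ends (w ++ L) P) = ends w P.
  elim/last_ind: L => [_ P _|L j IH EL P Pp0].
    by exists (cmap_id W), (cmap_id W); split=> // w; rewrite cats0.
  have Ej : E j by apply: EL; rewrite mem_rcons mem_head.
  have [|h [h' [hh' hP]]] := IH _ _ Pp0.
    by move=> i iL; apply: EL; rewrite mem_rcons inE iL orbT.
  have [P1 [Q [g1 [g1' [P1p Qp gg1 PQ1]]]]] := pp _ _ Ei0 Ej.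
  rewrite (lifts_uniq P1p Pp0) in PQ1.
  have [Q2 [P2 [g2 [g2' [Q2p P2p gg2 QP2]]]]] := pp _ _ Ej Ei0.
  rewrite (lifts_uniq P2p Pp0) (lifts_uniq Q2p Qp) in QP2.
  exists (cmap_comp h (cmap_comp g2 g1)), (cmap_comp (cmap_comp g1' g2') h').
  split; first by apply: deck_comp => //; apply: deck_comp.
  move=> w /=; rewrite -(hP w) -(QP2 (w ++ L)) PQ1; congr (h 0 (g2 0 _)).
  have [[u hQ] Qj] := Qp.
  rewrite /ends /ret -cats1 catA retracts_cat; congr (walkEnd _ (retracts _ _ _ _)).
  apply: (retract_id W_special A_face A_convex B_x hQ).
  by apply: alongA; rewrite Qj; case: (hp j Ej).
have [P Pp0] := lifts_ex (proj1 (hp i0 Ei0)); have [[u hP] eP] := Pp0.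
pose L := [seq i <- enum 'I_n | `[< E i >]].
have memL i : i \in L = `[< E i >] by rewrite mem_filter mem_enum andbT.
have [|g [g' [gg' hg]]] := shrink L _ P Pp0.
  by move=> j; rewrite memL => /asboolP.
have hL := ends_walk L hP.
exists (map (f 1) (ret L P)), (f 0 (ends L P)); split.
- exact: map_walk hL.
- move=> i Ei e /List.in_map_iff[E' [<- hE']].
  apply: (@retracts_along _ _ _ A A_face A_par B_x L i P _ _ hE').
  by rewrite memL; apply/asboolP.
- move=> i Ei; apply: sameEnds_trans (pp i0 i Ei0 Ei).
  exists (ret L P), P, g, g'; split=> //; first by split=> //; exists (ends L P).
  by move=> w; rewrite -hg /ends /ret retracts_cat.
Qed.

(** The walks are fixed by all imitators, and regularity provides a deck
    transformation that matches the ends of their lifts. *)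
Lemma sameEnds_all q1 q2 v : walk (f 0 w0) q1 v -> walk (f 0 w0) q2 v ->
  (forall i, along B i q1) -> (forall i, along B i q2) -> sameEnds q1 q2.
Proof.
move=> h1 h2 B1 B2; have [Q1 l1] := lifts_ex h1; have [Q2 l2] := lifts_ex h2.
have [[u1 w1] e1] := l1; have [[u2 w2] e2] := l2.
have alongA Q q i : map (f 1) Q = q -> along B i q -> along A i Q.
  by move=> <- h e he; apply: h; apply/List.in_map_iff; exists e.
have u12 : f 0 u1 = f 0 u2.
  have := map_walk f w1; rewrite e1 => /(walk_end h1) <-.
  by have := map_walk f w2; rewrite e2 => /(walk_end h2) <-.
have [g [g' [gg' gu]]] := f_regular u12.
exists Q1, Q2, g, g'; split=> // w; rewrite /ends /ret.
rewrite (retracts_id W_special A_face A_convex B_x w1) => [|i _]; last first.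
  exact: alongA e1 (B1 i).
rewrite (retracts_id W_special A_face A_convex B_x w2) => [|i _]; last first.
  exact: alongA e2 (B2 i).
by rewrite (walk_walkEnd w1) (walk_walkEnd w2).
Qed.

Lemma intersection_cover :
  exists (Xd : cubeComplex) (xd : Xd 0) (mu : cubeMap Xd X),
    [/\ covering mu, finite_sheeted mu, mu 0 xd = f 0 w0,
      forall (E : set 'I_n) u, (exists i, E i) ->
        (forall i, E i -> exists p, walk xd p u /\ along B i (map (mu 1) p)) ->
        exists q, walk xd q u /\ forall i, E i -> along B i (map (mu 1) q)
    & forall q1 q2 u1 u2, walk xd q1 u1 -> walk xd q2 u2 ->
        (forall i, along B i (map (mu 1) q1)) ->
        (forall i, along B i (map (mu 1) q2)) -> mu 0 u1 = mu 0 u2 -> u1 = u2].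
Proof.
have [T [h hT]] := sameEnds_finite.
have [Xd [xd [mu [mu_cov mu_fin mu_xd mu_end]]]] := @walk_cover X (f 0 w0) sameEnds T h
  sameEnds_sym sameEnds_trans sameEnds_end sameEnds_homotopy sameEnds_rcons hT.
have mu_walk p v : walk xd p v -> walk (f 0 w0) (map (mu 1) p) (mu 0 v).
  by move/(map_walk mu); rewrite mu_xd.
exists Xd, xd, mu; split=> //; last first.
  move=> q1 q2 u1 u2 h1 h2 B1 B2 u12; apply/(mu_end _ _ _ _ h1 h2).
  apply: (sameEnds_all (v := mu 0 u1)) => //; first exact: mu_walk.
  by rewrite u12; apply: mu_walk.
move=> E u E0 hE.
have /choice[p hp] : forall i, exists p, E i ->
    walk xd p u /\ along B i (map (mu 1) p).
  move=> i; have [/hE[p hp]|nE] := pselect (E i); first by exists p.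
  by exists [::].
have [||q [v' [hq Eq qp]]] := @sameEnds_inter E (mu 0 u) E0 (fun i => map (mu 1) (p i)).
- by move=> i /hp[h1 h2]; split=> //; apply: mu_walk.
- by move=> i j /hp[hi _] /hp[hj _]; apply/(mu_end _ _ _ _ hi hj).
rewrite -mu_xd in hq; have [Q [u' [hQ Qq _]]] := walk_lift mu_cov hq.
exists Q; rewrite Qq; split=> //; have [i Ei] := E0; have [hi _] := hp i Ei.
by suff <- : u' = u by []; apply/(mu_end _ _ _ _ hQ hi); rewrite Qq; apply: qp.
Qed.

End IntersectionCover.

(** * Elevations *)

Section Tracked.
Variables (X C Y : cubeCells) (kappa : cubeMap C X) (phi : cubeMap Y X).

(** [T] identifies a union of components of the pullback of [phi] and [kappa]
    with a subcomplex of [C]. *)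
Record trackedBy (T : forall m, C m -> Y m -> Prop) : Prop := TrackedBy {
  tracked_face : forall l m (f : faceMap l m) c t,
    T m c t -> T l (face f c) (face f t);
  tracked_comm : forall m c t, T m c t -> kappa m c = phi m t;
  tracked_uniq : forall m c t t', T m c t -> T m c t' -> t = t';
  tracked_local : forall m (c : C m) (t : Y m),
    T 0 (base c) (base t) -> kappa m c = phi m t -> T m c t
}.

End Tracked.

Section Elevation.
Variables (X C Y Xd : cubeComplex) (kappa : cubeMap C X) (phi : cubeMap Y X).
Variables (mu : cubeMap Xd C) (xd : Xd 0) (y : Y 0).
Variable T : forall m, C m -> Y m -> Prop.
Hypothesis kappa_cov : covering kappa.
Hypothesis mu_cov : covering mu.
Hypothesis T_tracked : trackedBy kappa phi T.
Hypothesis T_base : T (mu 0 xd) y.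
Variable D : basedElevation phi (cmap_comp kappa mu) y xd.

Let cov_D : covering (elev_cov D). Proof. exact: elev_covering. Qed.

Let B m (c : C m) : Prop := exists t, T c t.

(** The condition [T] propagates along walks from the base point, because it is
    preserved by faces and is decided at one vertex of a cube. *)
Lemma elev_tracked n (s : elev_dom D n) : T (mu n (elev_map D n s)) (elev_cov D n s).
Proof.
have local m (r : elev_dom D m) : T (mu 0 (elev_map D 0 (base r))) (elev_cov D 0 (base r)) ->
    T (mu m (elev_map D m r)) (elev_cov D m r).
  move=> h; apply: (tracked_local T_tracked); last exact: (elev_comm r).
  by rewrite !map_base.
apply: (local n s); have [_ /(_ (elev_base D) (base s))[//|//|p [hp _]]] :=
  cells_connected (elev_dom D).
have : T (mu 0 (elev_map D 0 (elev_base D))) (elev_cov D 0 (elev_base D)).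
  by rewrite elev_map_base elev_cov_base.
elim: p (elev_base D) hp => [v /= -> //|e p IH v /= [<- hp]] /(local 1 e) he.
by apply: IH hp _; rewrite -!map_tgt; apply: (tracked_face T_tracked).
Qed.

Lemma elev_cube m (s : Xd m) z : elev_map D 0 z = base s -> B (mu m s) ->
  exists t, base t = z /\ elev_map D m t = s.
Proof.
move=> zs [t st]; have bt : base t = elev_cov D 0 z.
  apply: (tracked_uniq T_tracked).
    exact: (tracked_face T_tracked (fm_vertex (corner0 m)) st).
  by rewrite -/(base _) map_base -zs; apply: elev_tracked.
have [t' [bt' ct']] := cov_lift cov_D bt.
exists t'; split=> //; apply: (cov_uniq (covering_comp kappa_cov mu_cov)).
  by rewrite map_base bt'.
by rewrite elev_comm ct' -(tracked_comm T_tracked st).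
Qed.

Lemma elev_walk P u : walk xd P u -> (forall e, List.In e (map (mu 1) P) -> B e) ->
  exists z, elev_map D 0 z = u.
Proof.
move=> hP BP; suff gen z0 v : elev_map D 0 z0 = v -> walk v P u ->
    exists z, elev_map D 0 z = u by apply: gen (elev_map_base D) hP.
move: BP => {hP} BP.
elim: P BP z0 v => [_ z v zv /= <-|e P IH BP z v zv /= [ez hP]]; first by exists z.
have [|f [fz fe]] := @elev_cube 1 e z (etrans zv (esym ez)).
  by apply: BP; left.
apply: (IH _ (tgt f) (tgt e)) => [e' he'||//]; first by apply: BP; right.
by rewrite -map_tgt fe.
Qed.

(** The image of the elevation in terms of walks in the subcomplex of [C] tracked
    by [T]; this is what the construction of the cover controls. *)
Lemma elev_rangeP m (s : Xd m) : range (elev_map D m) s <->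
  B (mu m s) /\ exists P, walk xd P (base s) /\
    forall e, List.In e (map (mu 1) P) -> B e.
Proof.
split=> [[t _ <-]|[Bs [P [hP BP]]]]; last first.
  by have [z /elev_cube/(_ Bs)[t [_ ts]]] := elev_walk hP BP; exists t.
split; first by exists (elev_cov D m t); apply: elev_tracked.
have [_ /(_ (elev_base D) (base t))[//|//|p [hp _]]] := cells_connected (elev_dom D).
exists (map (elev_map D 1) p); split.
  by have := map_walk (elev_map D) hp; rewrite elev_map_base map_base.
move=> e; rewrite -map_comp => /List.in_map_iff[e' [<- _]].
by exists (elev_cov D 1 e'); apply: elev_tracked.
Qed.

(** Points with the same image have the same projection to [Y] because [T] embeds
    into [C]; a walk between them then closes up in [Y] and in [Xd]. *)
Lemma elev_embedded : embedded (elev_map D).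
Proof.
move=> m s t st; have cst : elev_cov D m s = elev_cov D m t.
  apply: (tracked_uniq T_tracked) (elev_tracked s) _.
  by rewrite st; apply: elev_tracked.
apply: (cov_uniq cov_D) => //.
have [_ /(_ (base s) (base t))[//|//|p [hp _]]] := cells_connected (elev_dom D).
by apply/(elev_loops hp); rewrite -!map_base cst st.
Qed.

End Elevation.

Lemma connected_from (X : cubeCells) (A : forall m, set (X m)) (v0 : X 0) :
  A 0 v0 -> (forall e, A 1 e -> A 1 (reverse e)) ->
  (forall u, A 0 u -> exists p, walk v0 p u /\ forall e, List.In e p -> A 1 e) ->
  subcomplex_connected A.
Proof.
move=> Av0 Arev Astar; split=> [|u v /Astar[p [hp Ap]] /Astar[q [hq Aq]]]; first by exists v0.
have [p' [hp' Ap']] : exists p', walk u p' v0 /\ forall e, List.In e p' -> A 1 e.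
  elim: p v0 hp Ap {Av0 Astar hq} => [w /= -> _|e p IH w /= [<- hp] Ap].
    by exists [::].
  have [|p' [hp' Ap']] := IH _ hp; first by move=> e' he'; apply: Ap; right.
  exists (rcons p' (reverse e)); split.
    by rewrite -tgt_reverse; apply: walk_rcons; rewrite src_reverse.
  move=> e'; rewrite -cats1 => /List.in_app_iff[/Ap' //|[<-|//]].
  by apply: Arev; apply: Ap; left.
exists (p' ++ q); split; first exact: walk_cat hp' hq.
by move=> e /List.in_app_iff[/Ap'|/Aq].
Qed.

Section ElevationFamily.
Variables (n : nat) (X C Xd : cubeComplex) (Y : 'I_n -> cubeComplex).
Variables (kappa : cubeMap C X) (phi : forall i, cubeMap (Y i) X).
Variables (mu : cubeMap Xd C) (xd : Xd 0) (y : forall i, Y i 0).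
Variable T : forall i m, C m -> Y i m -> Prop.
Hypothesis kappa_cov : covering kappa.
Hypothesis mu_cov : covering mu.
Hypothesis T_tracked : forall i, trackedBy kappa (phi i) (@T i).
Hypothesis T_base : forall i, @T i 0 (mu 0 xd) (y i).

Let B i m : set (C m) := [set c | exists t, @T i m c t].

Hypothesis mu_inter : forall (E : set 'I_n) u, (exists i, E i) ->
  (forall i, E i -> exists p, walk xd p u /\ along B i (map (mu 1) p)) ->
  exists q, walk xd q u /\ forall i, E i -> along B i (map (mu 1) q).

Variable D : forall i, basedElevation (phi i) (cmap_comp kappa mu) (y i) xd.

Lemma elev_inter_walk (E : set 'I_n) m (s : Xd m) : (exists i, E i) ->
  elev_inter D E m s ->
  exists q, walk xd q (base s) /\ forall i, E i -> along B i (map (mu 1) q).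
Proof.
move=> E0 sE; apply: mu_inter => // i /sE.
by case/(elev_rangeP kappa_cov mu_cov (T_tracked i) (T_base i)).
Qed.

Lemma elev_inter_connected (E : set 'I_n) : (exists i, E i) ->
  subcomplex_connected (elev_inter D E).
Proof.
move=> E0; have rangeP i m (s : Xd m) :=
  elev_rangeP kappa_cov mu_cov (T_tracked i) (T_base i) (D i) s.
have inter_walk q u : walk xd q u -> (forall i, E i -> along B i (map (mu 1) q)) ->
    forall e, List.In e q -> elev_inter D E 1 e.
  move=> hq Eq e he i Ei; apply/rangeP; split.
    by apply: Eq => //; apply/List.in_map_iff; exists e.
  have [a [b eq]] := List.in_split _ _ he; rewrite eq in hq Eq.
  have [v [ha /= [ev _]]] := iffLR (walk_catE _ _ _ _) hq.
  exists a; split; first by rewrite [base e]ev.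
  move=> e' /List.in_map_iff[e1 [<- he1]]; apply: Eq => //.
  by apply/List.in_map_iff; exists e1; split=> //; apply/List.in_app_iff; left.
have vertex u : elev_inter D E 0 u -> exists q, walk xd q u /\
    forall e, List.In e q -> elev_inter D E 1 e.
  case/(elev_inter_walk E0) => q [hq Eq]; rewrite base_vertex in hq.
  by exists q; split=> //; apply: inter_walk hq Eq.
apply: (@connected_from _ _ xd) => // [i Ei|e Ee i /Ee[e' _ <-]].
  by exists (elev_base (D i)) => //; apply: elev_map_base.
by exists (reverse e') => //; rewrite -map_reverse.
Qed.

End ElevationFamily.

(** * Subcomplexes tracked by imitators *)

Section PullbackIsometry.
Variables (X Y Xh : cubeComplex) (phi : cubeMap Y X) (mu : cubeMap Xh X).
Hypothesis phi_isom : local_isometry phi.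

(** The imitators for [Y] move in the pullback, which unlike [Y] is mapped to the
    special complex [Xh]; it need not be connected. *)
Definition pbLeft : cubeMap (pullback phi mu) Y :=
  @CubeMap (pullback phi mu) Y (fun n s => (proj1_sig s).1) (fun m n f s => erefl).
Definition pbRight : cubeMap (pullback phi mu) Xh :=
  @CubeMap (pullback phi mu) Xh (fun n s => (proj1_sig s).2) (fun m n f s => erefl).

Lemma pb_comm n (s : pullback phi mu n) : phi n (pbLeft n s) = mu n (pbRight n s).
Proof. exact: (proj2_sig s). Qed.

Lemma pb_eq n (s t : pullback phi mu n) :
  pbLeft n s = pbLeft n t -> pbRight n s = pbRight n t -> s = t.
Proof.
move=> h1 h2; apply: sig_inj; rewrite [LHS]surjective_pairing.
by rewrite [RHS]surjective_pairing; congr pair.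
Qed.

Lemma pbRight_isom : local_isometry pbRight.
Proof.
move=> z; split=> [n s t sz tz st|n s sz h].
  apply: pb_eq => //; have [inj _] := phi_isom (pbLeft 0 z).
  by apply: inj; rewrite ?map_base ?sz ?tz // !pb_comm st.
have bs : base (mu n s) = phi 0 (pbLeft 0 z) by rewrite map_base sz pb_comm.
have [|t [tz ts]] := (proj2 (phi_isom _)) n _ bs.
  move=> i; have [e [ez es]] := h i; exists (pbLeft 1 e).
  by rewrite map_src ez pb_comm es map_axis.
pose st : pullback phi mu n :=
  exist (fun p : Y n * Xh n => phi n p.1 = mu n p.2) (t, s) ts.
by exists st; split=> //; apply: pb_eq; rewrite -map_base.
Qed.

Lemma pb_finite : finite_set [set: Y 0] -> finite_set [set: Xh 0] ->
  finite_set [set: pullback phi mu 0].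
Proof.
move=> /finite_code[T [f f_inj]] /finite_code[T' [f' f'_inj]].
apply: (@finite_inj _ _ _ (fun s => (f (pbLeft 0 s), f' (pbRight 0 s)))) => s t _ _.
by case=> /f_inj h /f'_inj; apply: pb_eq h.
Qed.

Variables (C : cubeComplex) (kappa : cubeMap C Xh) (pos : C 0 -> pullback phi mu 0).
Hypothesis Xh_special : special Xh.
Hypothesis pos_step : forall e,
  pos (tgt e) = imitStep pbRight (pos (src e)) (kappa 1 e).

Definition pbTracks m (c : C m) (t : Y m) : Prop :=
  exists s, tracks kappa pbRight pos c s /\ pbLeft m s = t.

Lemma pbTracks_tracked : trackedBy (cmap_comp mu kappa) phi pbTracks.
Proof.
split=> [l m f c t [s [cs <-]]|m c t [s [[_ cs] <-]]|m c t t' [s [cs <-]] [s' [cs' <-]]|].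
- by exists (face f s); split=> //; apply: (tracks_face Xh_special pbRight_isom pos_step).
- by rewrite pb_comm cs.
- by rewrite (tracks_uniq pbRight_isom cs cs').
move=> m c t [z [[bz cz] zt]] ct.
pose s : pullback phi mu m :=
  exist (fun p : Y m * Xh m => phi m p.1 = mu m p.2) (t, kappa m c) (esym ct).
exists s; split=> //; split=> //; rewrite !base_vertex in bz; rewrite -bz.
by apply: pb_eq; [rewrite zt -map_base|rewrite cz -!map_base].
Qed.

End PullbackIsometry.

(** * Embedded subcomplexes *)

Section EmbeddedTracked.
Variables (X Y : cubeComplex) (phi : cubeMap Y X).
Hypothesis phi_isom : local_isometry phi.
Hypothesis phi_emb : embedded phi.

Lemma embedded_tracked : trackedBy (cmap_id X) phi (fun m c t => phi m t = c).
Proof.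
split=> [l m f c t <-|m c t <-|m c t t' <- /phi_emb|m c t _ <-] //.
by rewrite cmap_face.
Qed.

Lemma embedded_convex : convex (fun m => [set c | exists t, phi m t = c]).
Proof.
move=> m s /= [z sz] h; have [|t [_ ts]] := (proj2 (phi_isom z)) m s (esym sz).
  move=> i; have [e es] := h i; exists e; split=> //; apply: phi_emb.
  by rewrite -map_src es src_axis.
by exists t.
Qed.

Hypothesis phi_osc : forall H, hyperplane H -> ~ hyp_map_inter_osculate phi H.

Lemma embedded_par (e e' : X 1) : parallel e e' -> (exists t, phi 1 t = e') ->
  (exists z, phi 0 z = src e) -> exists t, phi 1 t = e.
Proof.
move=> ee' [t te'] [z ze]; apply: contrapT => ne.
apply: (phi_osc (ex_intro _ e erefl : hyperplane (hyp e))); split.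
  by exists t; rewrite te'; apply: hyp_eq.
exists z, e; split=> //; first by left.
case=> f [_ [ef|ef]]; apply: ne; first by exists f.
by exists (reverse f); rewrite -map_reverse ef.
Qed.

End EmbeddedTracked.

(** * Two applications of the intersection cover *)

Theorem theorem1p8 (n : nat) (X : cubeComplex) (x : X 0)
    (Y : 'I_n -> cubeComplex) (y : forall i, Y i 0)
    (phi : forall i, cubeMap (Y i) X)
    (X_finite : finite_complex X) (X_special : virtually_special X)
    (Y_finite : forall i, finite_complex (Y i))
    (Y_special : forall i, virtually_special (Y i))
    (phi_isom : forall i, local_isometry (phi i))
    (phi_base : forall i, phi i 0 (y i) = x) :
  (exists (Xd : cubeComplex) (xd : Xd 0) (mu : cubeMap Xd X),
    [/\ covering mu, finite_sheeted mu, mu 0 xd = x &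
      forall D : (forall i, basedElevation (phi i) mu (y i) xd),
        (forall i, embedded (elev_map (D i))) /\
        (forall E : set 'I_n, (exists i, E i) ->
           subcomplex_connected (elev_inter D E))]) /\
  ((forall i, embedded (phi i)) ->
   (forall i H, hyperplane H -> ~ hyp_map_inter_osculate (phi i) H) ->
   exists (Xd : cubeComplex) (xd : Xd 0) (mu : cubeMap Xd X),
    [/\ covering mu, finite_sheeted mu, mu 0 xd = x &
      forall D : (forall i, basedElevation (phi i) mu (y i) xd),
        [/\ (forall i, embedded (elev_map (D i))),
            (forall E : set 'I_n, (exists i, E i) ->
               subcomplex_connected (elev_inter D E)) &
            (forall m (s t : Xd m),
               elev_inter D setT m s -> elev_inter D setT m t ->
               mu m s = mu m t -> s = t)]]).
Proof.
have [_ [X' [kappa' [k'_cov k'_fin /directly_special_special X'_special]]]] := X_special.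
have X0_fin := finite_vertices X_finite.
have X'0_fin := finite_cover X0_fin k'_fin.
have [x' x'x] := covering_surj k'_cov x.
split=> [|phi_emb phi_osc].
  pose psi i := pbRight (phi i) kappa'.
  have z_eq i : phi i 0 (y i) = kappa' 0 x' by rewrite phi_base x'x.
  pose z i : pullback (phi i) kappa' 0 :=
    exist (fun p : Y i 0 * X' 0 => phi i 0 p.1 = kappa' 0 p.2) (y i, x') (z_eq i).
  have psi_isom i : local_isometry (psi i) := pbRight_isom (phi_isom i).
  (* The local isometries are pulled back to the special cover [X'], in which the
     walker moves. *)
  have [i|C [c0 [kC [pos [kC_cov kC_fin kc0 pos_c0 pos_step]]]]] :=
    imitator_cover x' z X'_special psi_isom.
    by apply: pb_finite => //; apply: finite_vertices.
  pose T i m (c : C m) (t : Y i m) := pbTracks kC (pos i) c t.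
  have T_tracked i : trackedBy (cmap_comp kappa' kC) (phi i) (@T i).
    exact: (pbTracks_tracked (phi_isom i) X'_special (pos_step i)).
  have T_c0 i : T i 0 c0 (y i).
    by exists (z i); split=> //; split; rewrite ?kc0 // !base_vertex pos_c0.
  pose B i m : set (C m) := [set c | exists t, T i m c t].
  have BE i m (c : C m) : B i m c <-> exists s, tracks kC (psi i) (pos i) c s.
    split=> [[t [s [cs _]]]|[s cs]]; first by exists s.
    by exists (pbLeft (phi i) kappa' m s), s.
  (* [C] is special, hence its own regular cover with trivial deck group. *)
  have [||||||||Xd [xd [mu [mu_cov mu_fin mu_xd mu_inter _]]]] :=
    @intersection_cover n C C (cmap_id C) c0 B.
  - by move=> c m s sc; exists s; split=> // t [_ /esym].
  - exact: special_cover kC_cov X'_special.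
  - exact: finite_cover X'0_fin kC_fin.
  - by move=> u v uv; exists (cmap_id C), (cmap_id C); split=> //; apply: deck_id.
  - by move=> i l m h s [t st]; exists (face h t); apply: (tracked_face (T_tracked i)).
  - move=> i m s /BE sb sa; apply/BE; apply: (tracks_convex (psi_isom i)) => // j.
    exact/BE.
  - move=> i e e' ee' /BE he' /BE he; apply/BE.
    exact: (tracks_par X'_special (psi_isom i) (pos_step i) ee').
  - by move=> i; exists (y i); apply: T_c0.
  have T_xd i : T i 0 (mu 0 xd) (y i) by rewrite mu_xd; apply: T_c0.
  have k_cov := covering_comp k'_cov kC_cov.
  exists Xd, xd, (cmap_comp (cmap_comp kappa' kC) mu); split.
  - exact: covering_comp k_cov mu_cov.
  - exact: finite_sheeted_comp (finite_sheeted_comp k'_fin kC_fin) mu_fin.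
  - by rewrite /= mu_xd /= kc0.
  move=> D; split=> [i|E E0].
    exact: (elev_embedded (T_tracked i) (T_xd i)).
  exact: (elev_inter_connected k_cov mu_cov T_tracked T_xd mu_inter).
have [W [f [w0 [f_cov fw0 W_special W_fin f_reg]]]] :=
  regular_cover k'_cov (ex_intro _ x' x'x) X'_special X'0_fin.
pose B i m : set (X m) := [set c | exists t, phi i m t = c].
have [||||||||Xd [xd [mu [mu_cov mu_fin mu_xd mu_inter mu_inj]]]] :=
  @intersection_cover n X W f w0 B.
- exact: f_cov.
- exact: W_special.
- exact: W_fin.
- exact: f_reg.
- by move=> i l m h s [t <-]; exists (face h t); rewrite cmap_face.
- move=> i; exact: (embedded_convex (phi_isom i) (@phi_emb i)).
- move=> i e e'; exact: (embedded_par (@phi_osc i)).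
- by move=> i; exists (y i); rewrite fw0.
rewrite fw0 in mu_xd.
have T_tracked i := embedded_tracked (phi_emb i).
have T_xd i : phi i 0 (y i) = mu 0 xd by rewrite mu_xd.
have id_cov : covering (cmap_id X).
  by move=> c m s sc; exists s; split=> // t [_ /esym].
exists Xd, xd, (cmap_comp (cmap_id X) mu); split=> //.
move=> D; split=> [i|E E0|m s t].
- exact: (elev_embedded (T_tracked i) (T_xd i)).
- exact: (elev_inter_connected id_cov mu_cov T_tracked T_xd mu_inter).
move=> s_in t_in st; suff bst : base s = base t by apply: (cov_uniq mu_cov).
have reach_all r : elev_inter D setT m r ->
    exists q, walk xd q (base r) /\ forall i, along B i (map (mu 1) q).
  have [i0|no_i] := pselect (exists i : 'I_n, True).
    case/(elev_inter_walk id_cov mu_cov T_tracked T_xd mu_inter i0) => q [hq Bq].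
    by exists q; split=> // i; apply: Bq.
  (* For [n = 0] the intersection is the whole of [Xd]. *)
  have [_ /(_ xd (base r))[//|//|q [hq _]]] := cells_connected Xd.
  by exists q; split=> // i; case: no_i; exists i.
have [p [hp Bp]] := reach_all _ s_in; have [q [hq Bq]] := reach_all _ t_in.
by apply: mu_inj hp hq Bp Bq _; rewrite -!map_base st.
Qed.
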